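(* For all positive integers $m$ and $p$, $$2\sum_{n=1}^\infty\frac{T_n(\{1\}_{2m-2})\,T_n(\{1\}_{2p-2})}{2n-1}(-1)^n=(-1)^{m-1}\sum_{j=1}^pW(2j+2m-3,2m-1)\,Z(j,p).$$
   Context: $\{1\}_a$ denotes the sequence of $a$ ones. $T_n(\emptyset):=1$, and for $n\ge1$, $a\ge1$: $T_n(\{1\}_{2a})=\sum\frac{2^{2a}}{\prod_{i=1}^a(2n_{2i-1}-1)(2n_{2i})}$, summed over integers $0<n_1\le n_2<n_3\le n_4<\cdots<n_{2a-1}\le n_{2a}<n$ (empty sum $=0$). For positive integers $k_1,\dots,k_r$, $\bar T(k_1,\ldots,k_r):=2^r\sum_{0<n_1<\cdots<n_r}\frac{(-1)^{n_r}}{(2n_1-1)^{k_1}(2n_2-2)^{k_2}\cdots(2n_r-r)^{k_r}}$. $I(k,r)$ is the set of tuples of positive integers $(k_1,\dots,k_r)$ with sum $k$; $W(k,r):=\sum_{(k_1,\dots,k_r)\in I(k,r)}\bar T(k_1,\dots,k_r)$. $\bar\zeta(s):=\sum_{n\ge1}(-1)^{n-1}n^{-s}$ for $s\ge1$, $\bar\zeta(0):=1/2$. For $1\le j\le p$: $Z(p,p):=1$ and for $j<p$, $Z(j,p):=\sum_{k=1}^{p-j}(-2)^k\sum_{j=i_0<i_1<\cdots<i_k=p}\prod_{l=1}^k\bar\zeta(2i_l-2i_{l-1})$. *)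

(* Defs.v *)
From Stdlib Require Import Reals List Arith Bool.
From Coquelicot Require Import Coquelicot.
Import ListNotations.
Open Scope R_scope.

Definition lsum (l : list R) : R := fold_right Rplus 0 l.

(* sum_{n = a}^{b} f n  (empty, i.e. 0, when b < a) *)
Definition fsum (a b : nat) (f : nat -> R) : R :=
  lsum (map f (seq a (S b - a))).

Fixpoint all_lists (r k : nat) : list (list nat) :=
  match r with
  | O => [nil]
  | S r' => flat_map (fun x => map (cons x) (all_lists r' k)) (seq 1 k)
  end.

Definition nsum (l : list nat) : nat := fold_right Nat.add 0%nat l.

Fixpoint incr (l : list nat) : bool :=
  match l with
  | a :: ((b :: _) as t) => andb (Nat.ltb a b) (incr t)
  | _ => true
  end.

Fixpoint prod_diffs (f : nat -> R) (l : list nat) : R :=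
  match l with
  | a :: ((b :: _) as t) => f (b - a)%nat * prod_diffs f t
  | _ => 1
  end.

(* Tsum a N = T_N({1}_{2a}) =
   sum over 0<n1<=n2<n3<=...<n_{2a-1}<=n_{2a}<N of
   2^{2a} / prod_{i=1}^a (2 n_{2i-1} - 1)(2 n_{2i});  Tsum 0 N = 1. *)
Fixpoint Tsum (a N : nat) : R :=
  match a with
  | O => 1
  | S a' =>
      fsum 1 (N - 1) (fun u =>
        fsum u (N - 1) (fun v =>
          Tsum a' u * 4 / ((2 * INR u - 1) * (2 * INR v))))
  end.

(* Grev [k_i; k_{i-1}; ...; k_1] N =
   sum over 0<n1<...<n_i<N of prod_{l=1}^i 1/(2 n_l - l)^{k_l} *)
Fixpoint Grev (rks : list nat) (N : nat) : R :=
  match rks with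
  | nil => 1
  | k :: rest =>
      fsum 1 (N - 1) (fun n =>
        Grev rest n / (2 * INR n - INR (length rks)) ^ k)
  end.

(* \bar T(k_1,...,k_r) = 2^r sum_{0<n1<...<nr} (-1)^{n_r} / prod (2n_i - i)^{k_i},
   the outer summation being over n_r (series in n_r). *)
Definition barT (ks : list nat) : R :=
  match rev ks with
  | nil => 1
  | k :: rest =>
      2 ^ length ks *
      Series (fun N0 => let N := S N0 in
        (-1) ^ N / (2 * INR N - INR (length ks)) ^ k * Grev rest N)
  end.

Definition W (k r : nat) : R :=
  lsum (map barT (filter (fun ks => Nat.eqb (nsum ks) k) (all_lists r k))).

Definition zetabar (s : nat) : R :=
  match s with
  | O => 1 / 2
  | _ => Series (fun n => (-1) ^ n / (INR (S n)) ^ s)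
  end.

Definition Zc (j p : nat) : R :=
  if Nat.eqb j p then 1 else
  fsum 1 (p - j) (fun k =>
    (-2) ^ k *
    lsum (map (fun l => prod_diffs (fun d => zetabar (2 * d)) (j :: l))
      (filter (fun l => andb (incr (j :: l)) (Nat.eqb (last l j) p))
              (all_lists k p)))).

(* Main.v *)
Require Import Defs.
From Stdlib Require Import Reals List Arith Lra Lia Permutation.
From Coquelicot Require Import Coquelicot.
Import ListNotations.
Open Scope R_scope.

(* For continuous [f] let [Lam (S s) f] be the integral of [(- ln u)^s / s! * f u] over [0, 1], and
   put [v = (1 - u) / (1 + u)].

   Integrating by parts, the moments of [2 v^(2n-2) / (1 + u)^2] satisfy the recursion that defines
   the [T_n], so [(2n - 1)] times the moment with weight [(ln u)^(2q) / (2q)!] equals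
   [sum_b T_n({1}_{2b}) * 2 zetabar(2q - 2b)]; the matrix [Z(j, p)] inverts this convolution.
   Moreover [sum_n (-1)^(n-1) T_n({1}_{2a}) v^(2n-2)] is, up to the sign [(-1)^a], the expansion of
   [(2 atan v)^(2a) / (2a)! / (1 + v^2)]. Hence the left-hand side of the theorem is the combination
   with coefficients [Z(j, p)] of the integrals of [(ln u)^(2j-2) / (2j-2)!] against
   [(2 atan v)^(2m-2) / (2m-2)! / (1 + u^2)].

   Since the derivative of [2 atan v] with respect to [u] is [- 2 / (1 + u^2)], expanding
   [1 / (1 + u^2)] in powers of [u] and integrating by parts repeatedly turns the [j]-th integral
   into the sum defining [W(2j + 2m - 3, 2m - 1)]. *)

(** The series on both sides converge only conditionally in general, with terms of the size of a
    power of a logarithm over n, so absolute bounds cannot justify exchanging sums and integrals.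
    Every infinite sum is therefore obtained from a finite identity with an explicit remainder, and
    the remainder is at most a sequence of polylogarithmic growth divided by n + 1; [slow] records
    that growth and survives every operation applied to the coefficients.

    The substitution v = (1 - u)/(1 + u) is dictated by two identities, 2 du/(1 + u)^2 = - dv and
    du/(1 + u^2) = - dv/(1 + v^2). They allow one integral to be expanded in powers of v, where the
    moments produce T_n, or in powers of u, where they produce W. The factors 2 zetabar enter as the
    integrals of 2/(1 + u) against powers of the logarithm, the initial values of the recursion for
    the moments. *)

(** * Finite sums and Cauchy products *)

Fixpoint rsum (n : nat) (f : nat -> R) : R :=
  match n with O => 0 | S n' => rsum n' f + f n' end.

Lemma rsum_ext n f g : (forall i, (i < n)%nat -> f i = g i) -> rsum n f = rsum n g.
Proof. induction n; simpl; intros H; [easy|]. rewrite IHn, H; auto. Qed.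

Lemma rsum_plus n f g : rsum n (fun i => f i + g i) = rsum n f + rsum n g.
Proof. induction n; simpl; [|rewrite IHn]; ring. Qed.

Lemma rsum_scal n c f : rsum n (fun i => c * f i) = c * rsum n f.
Proof. induction n; simpl; [|rewrite IHn]; ring. Qed.

Lemma rsum_0 n f : (forall i, (i < n)%nat -> f i = 0) -> rsum n f = 0.
Proof. induction n; simpl; intros H; [easy|]. rewrite IHn, H; auto; ring. Qed.

Lemma rsum_le n f g : (forall i, (i < n)%nat -> f i <= g i) -> rsum n f <= rsum n g.
Proof. induction n; simpl; intros H; [lra|]. apply Rplus_le_compat; auto. Qed.

Lemma rsum_abs n f : Rabs (rsum n f) <= rsum n (fun i => Rabs (f i)).
Proof.
  induction n; simpl; [rewrite Rabs_R0; lra|].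
  eapply Rle_trans; [apply Rabs_triang|]. lra.
Qed.

Lemma rsum_head n f : rsum (S n) f = f 0%nat + rsum n (fun i => f (S i)).
Proof. induction n; [simpl; ring|]. simpl in *. rewrite IHn. ring. Qed.

Lemma rsum_swap n m f :
  rsum n (fun i => rsum m (fun j => f i j)) = rsum m (fun j => rsum n (fun i => f i j)).
Proof.
  induction n; simpl; [symmetry; apply rsum_0; easy|].
  rewrite IHn, <- rsum_plus. now apply rsum_ext.
Qed.

Lemma rsum_app n m f : rsum (n + m) f = rsum n f + rsum m (fun i => f (n + i)%nat).
Proof.
  induction m; simpl; [rewrite Nat.add_0_r; ring|].
  rewrite Nat.add_succ_r. simpl. rewrite IHm. ring.
Qed.

Lemma rsum_triangle s F :
  rsum (S s) (fun t => rsum (S t) (F t)) =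
  rsum (S s) (fun j => rsum (S (s - j)) (fun i => F (j + i)%nat j)).
Proof.
  induction s; [reflexivity|].
  change (rsum (S (S s)) (fun t => rsum (S t) (F t))) with
    (rsum (S s) (fun t => rsum (S t) (F t)) + (rsum (S s) (F (S s)) + F (S s) (S s))).
  rewrite IHs.
  set (G := fun j => rsum (S (S s - j)) (fun i => F (j + i)%nat j)).
  change (rsum (S (S s)) G) with (rsum (S s) G + G (S s)).
  assert (HG : G (S s) = F (S s) (S s)).
  { unfold G. rewrite Nat.sub_diag. simpl. rewrite Nat.add_0_r. ring. }
  rewrite HG, <- Rplus_assoc, <- rsum_plus. f_equal. apply rsum_ext. intros j Hj.
  unfold G. replace (S s - j)%nat with (S (s - j)) by lia. cbn [rsum].
  replace (j + S (s - j))%nat with (S s) by lia. reflexivity.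
Qed.

(** Sequences stand for formal power series in an auxiliary variable and [conv] for their product,
    so generating function arguments need no convergence. *)
Definition conv (a b : nat -> R) (s : nat) : R :=
  rsum (S s) (fun t => a t * b (s - t)%nat).

Lemma conv_ext a a' b b' s : (forall t, (t <= s)%nat -> a t = a' t) ->
  (forall t, (t <= s)%nat -> b t = b' t) -> conv a b s = conv a' b' s.
Proof.
  intros Ha Hb. apply rsum_ext. intros t Ht. rewrite Ha, Hb; auto; lia.
Qed.

Lemma conv_assoc a b c s : conv (conv a b) c s = conv a (conv b c) s.
Proof.
  unfold conv at 1 3.
  rewrite (rsum_ext _ _ (fun t => rsum (S t) (fun j => a j * b (t - j)%nat * c (s - t)%nat))).
  2:{ intros t _. unfold conv. rewrite Rmult_comm, <- rsum_scal. apply rsum_ext.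
      intros; ring. }
  rewrite (rsum_triangle s (fun t j => a j * b (t - j)%nat * c (s - t)%nat)).
  apply rsum_ext. intros j Hj. unfold conv. rewrite <- rsum_scal. apply rsum_ext.
  intros i Hi. replace (j + i - j)%nat with i by lia.
  replace (s - (j + i))%nat with (s - j - i)%nat by lia. ring.
Qed.

Lemma conv_plus_l a a' b s : conv (fun t => a t + a' t) b s = conv a b s + conv a' b s.
Proof. unfold conv. rewrite <- rsum_plus. apply rsum_ext; intros; ring. Qed.

Lemma conv_plus_r a b b' s : conv a (fun t => b t + b' t) s = conv a b s + conv a b' s.
Proof. unfold conv. rewrite <- rsum_plus. apply rsum_ext; intros; ring. Qed.

Lemma conv_scal_r a b c s : conv a (fun t => c * b t) s = c * conv a b s.
Proof. unfold conv. rewrite <- rsum_scal. apply rsum_ext; intros; ring. Qed.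

Lemma conv_comm a b s : conv a b s = conv b a s.
Proof.
  unfold conv.
  assert (H : forall n f, rsum n f = rsum n (fun i => f (n - 1 - i)%nat)).
  { induction n; intros f; [reflexivity|].
    rewrite rsum_head. cbn [rsum]. rewrite (IHn (fun i => f (S i))).
    replace (S n - 1 - n)%nat with 0%nat by lia. rewrite Rplus_comm. f_equal.
    apply rsum_ext. intros i Hi. f_equal. lia. }
  rewrite H. apply rsum_ext. intros i Hi.
  replace (S s - 1 - i)%nat with (s - i)%nat by lia.
  replace (s - (s - i))%nat with i by lia. ring.
Qed.

Lemma lsum_seq f n a : lsum (map f (seq a n)) = rsum n (fun i => f (a + i)%nat).
Proof.
  revert a; induction n; intros a; [reflexivity|].
  rewrite rsum_head. simpl. rewrite Nat.add_0_r. f_equal. rewrite IHn.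
  apply rsum_ext; intros; f_equal; lia.
Qed.

Lemma fsum_rsum a b f : fsum a b f = rsum (S b - a) (fun i => f (a + i)%nat).
Proof. apply lsum_seq. Qed.

Lemma sum_n_rsum f n : sum_n f n = rsum (S n) f.
Proof.
  induction n; [rewrite sum_O; symmetry; apply Rplus_0_l|].
  rewrite sum_Sn, IHn. reflexivity.
Qed.

Lemma is_series_rsum f (l : R) : is_lim_seq (fun n => rsum n f) l -> is_series f l.
Proof.
  intros H. apply is_lim_seq_incr_1 in H.
  apply (is_lim_seq_ext _ (sum_n f)) in H; [exact H|].
  intros n. now rewrite sum_n_rsum.
Qed.

Lemma is_series_rsum_inv f (l : R) : is_series f l -> is_lim_seq (fun n => rsum n f) l.
Proof.
  intros H. apply is_lim_seq_incr_1.
  apply (is_lim_seq_ext (sum_n f)); [|exact H].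
  intros n. now rewrite sum_n_rsum.
Qed.

(** * Sequences of polylogarithmic growth and convergence criteria *)

(** The added 1 keeps the value at least 1 from n = 0 on, so powers grow with the exponent and two
    bounds can be brought to a common exponent. *)
Definition plog (n : nat) : R := 1 + ln (INR n + 1).

Definition slow (f : nat -> R) : Prop :=
  exists C r, 0 <= C /\ forall n, Rabs (f n) <= C * plog n ^ r.

Lemma plog_ge1 n : 1 <= plog n.
Proof.
  unfold plog. assert (0 <= ln (INR n + 1)); [|lra].
  rewrite <- ln_1. apply ln_le; [lra|]. pose proof (pos_INR n); lra.
Qed.

Lemma plog_le n m : (n <= m)%nat -> plog n <= plog m.
Proof.
  intros H. unfold plog. apply Rplus_le_compat_l, ln_le.
  - pose proof (pos_INR n); lra.
  - apply le_INR in H. lra.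
Qed.

Lemma plog_step n : / (INR n + 2) <= plog (S n) - plog n.
Proof.
  unfold plog. rewrite S_INR. pose proof (pos_INR n) as Hn.
  assert (H : ln ((INR n + 1) / (INR n + 2)) <= (INR n + 1) / (INR n + 2) - 1).
  { assert (H1 : 0 < (INR n + 1) / (INR n + 2)) by (apply Rdiv_lt_0_compat; lra).
    pose proof (exp_ineq1_le (ln ((INR n + 1) / (INR n + 2)))) as H2.
    rewrite exp_ln in H2 by exact H1. lra. }
  rewrite ln_div in H by lra.
  replace ((INR n + 1) / (INR n + 2) - 1) with (- / (INR n + 2)) in H by (field; lra).
  replace (INR n + 1 + 1) with (INR n + 2) by ring. lra.
Qed.

Lemma plog_pow_le n m r : (n <= m)%nat -> plog n ^ r <= plog m ^ r.
Proof.
  intros H. apply pow_incr. split; [pose proof (plog_ge1 n); lra|now apply plog_le].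
Qed.

Lemma plog_pow_ge1 n r : 1 <= plog n ^ r.
Proof. apply pow_R1_Rle, plog_ge1. Qed.

Lemma slow_weaken f C r k : 0 <= C -> (forall n, Rabs (f n) <= C * plog n ^ r) ->
  forall n, Rabs (f n) <= C * plog n ^ (r + k).
Proof.
  intros HC H n. eapply Rle_trans; [apply H|]. apply Rmult_le_compat_l; [easy|].
  apply Rle_pow; [apply plog_ge1|lia].
Qed.

Lemma slow_le f g : slow g -> (forall n, Rabs (f n) <= Rabs (g n)) -> slow f.
Proof. intros [C [r [HC H]]] Hf. exists C, r. split; [easy|]. intros n. eapply Rle_trans; eauto. Qed.

Lemma slow_const c : slow (fun _ => c).
Proof.
  exists (Rabs c), 0%nat. split; [apply Rabs_pos|]. intros n. simpl. lra.
Qed.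

Lemma slow_plus f g : slow f -> slow g -> slow (fun n => f n + g n).
Proof.
  intros [C [r [HC H]]] [C' [r' [HC' H']]]. exists (C + C'), (r + r')%nat.
  split; [lra|]. intros n.
  pose proof (slow_weaken f C r r' HC H n). pose proof (slow_weaken g C' r' r HC' H' n).
  rewrite (Nat.add_comm r' r) in H1.
  pose proof (Rabs_triang (f n) (g n)). lra.
Qed.

Lemma slow_mult f g : slow f -> slow g -> slow (fun n => f n * g n).
Proof.
  intros [C [r [HC H]]] [C' [r' [HC' H']]]. exists (C * C'), (r + r')%nat.
  split; [now apply Rmult_le_pos|]. intros n.
  rewrite Rabs_mult, pow_add.
  replace (C * C' * (plog n ^ r * plog n ^ r')) with ((C * plog n ^ r) * (C' * plog n ^ r')) by ring.
  apply Rmult_le_compat; auto using Rabs_pos.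
Qed.

Lemma slow_rsum k (f : nat -> nat -> R) :
  (forall i, (i < k)%nat -> slow (f i)) -> slow (fun n => rsum k (fun i => f i n)).
Proof.
  induction k; intros H; simpl; [apply slow_const|].
  apply slow_plus; auto.
Qed.

(** Summing against 1/(n + 1) costs one logarithm: by [plog_step] the increments of [plog] dominate
    the harmonic terms up to a constant, and the monotone factor [plog n ^ r] can be replaced by its
    last value. *)
Lemma slow_partial_sums f g : slow g ->
  (forall n, Rabs (f n) <= Rabs (g n) / (INR n + 1)) -> slow (fun n => rsum n f).
Proof.
  intros [C [r [HC H]]] Hf. exists (2 * C), (S r). split; [lra|].
  assert (Hs : forall n, Rabs (rsum n f) <= 2 * C * plog n ^ r * (plog n - 1)).
  { induction n.
    - simpl. rewrite Rabs_R0. unfold plog. simpl. rewrite Rplus_0_l, ln_1. lra.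
    - cbn [rsum]. eapply Rle_trans; [apply Rabs_triang|].
      (* The factor 2 pays for passing from 1/(n + 2), which [plog_step] provides, to 1/(n + 1). *)
      assert (H1 : Rabs (f n) <= 2 * C * plog n ^ r * (plog (S n) - plog n)).
      { eapply Rle_trans; [apply Hf|]. pose proof (plog_step n). pose proof (pos_INR n).
        apply Rle_trans with (C * plog n ^ r * / (INR n + 1)).
        - apply Rmult_le_compat_r; [|apply H]. left; apply Rinv_0_lt_compat; lra.
        - assert (0 <= C * plog n ^ r).
          { apply Rmult_le_pos; [easy|]. pose proof (plog_pow_ge1 n r); lra. }
          assert (/ (INR n + 1) <= 2 * / (INR n + 2)).
          { apply Rmult_le_reg_r with ((INR n + 1) * (INR n + 2)); [nra|].
            field_simplify; lra. }
          nra. }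
      pose proof (plog_ge1 n). pose proof (plog_le n (S n) ltac:(lia)).
      pose proof (plog_pow_le n (S n) r ltac:(lia)).
      apply Rle_trans with (2 * C * plog n ^ r * (plog (S n) - 1)); [lra|].
      apply Rmult_le_compat_r; [lra|]. nra. }
  intros n. eapply Rle_trans; [apply Hs|]. simpl.
  pose proof (plog_ge1 n). pose proof (plog_pow_ge1 n r).
  assert (0 <= 2 * C * plog n ^ r) by (apply Rmult_le_pos; lra).
  nra.
Qed.

(** The inequality y <= exp y at y = x/n, raised to the n-th power. *)
Lemma pow_le_exp n x : (1 <= n)%nat -> 0 <= x -> x ^ n <= INR n ^ n * exp x.
Proof.
  intros Hn Hx.
  assert (Hn' : 0 < INR n) by (apply lt_0_INR; lia).
  assert (E : exp x = exp (x / INR n) ^ n).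
  { assert (G : forall k y, exp (INR k * y) = exp y ^ k).
    { induction k; intros y; [simpl; now rewrite Rmult_0_l, exp_0|].
      rewrite S_INR, Rmult_plus_distr_r, Rmult_1_l, exp_plus, IHk. simpl. ring. }
    rewrite <- G. f_equal. field. lra. }
  rewrite E, <- Rpow_mult_distr. apply pow_incr. split; [easy|].
  pose proof (exp_ineq1_le (x / INR n)).
  apply Rle_trans with (INR n * (x / INR n)).
  - right. field. lra.
  - apply Rmult_le_compat_l; lra.
Qed.

(** Since [exp (plog n)] is e (n + 1), this is [pow_le_exp] at [plog n]; passing to [S r] makes the
    exponent positive and explains the constant. *)
Lemma plog_pow_le_linear r : exists K, 0 < K /\ forall n, plog n ^ r <= K * (INR n + 1).
Proof.
  exists (INR (S r) ^ S r * exp 1).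
  assert (HS : 0 < INR (S r) ^ S r) by (apply pow_lt, lt_0_INR; lia).
  split; [apply Rmult_lt_0_compat; [easy|apply exp_pos]|].
  intros n. pose proof (plog_ge1 n). pose proof (pos_INR n).
  apply Rle_trans with (plog n ^ S r); [apply Rle_pow; [easy|lia]|].
  eapply Rle_trans; [apply pow_le_exp; [lia|lra]|].
  unfold plog. rewrite exp_plus, exp_ln by lra. lra.
Qed.

Lemma is_lim_seq_plog : is_lim_seq plog p_infty.
Proof.
  apply (is_lim_seq_ext (fun n => 1 + ln (INR n + 1))); [reflexivity|].
  apply (is_lim_seq_plus _ _ 1 p_infty); [apply is_lim_seq_const| |reflexivity].
  apply (is_lim_comp_seq ln _ p_infty p_infty); [apply is_lim_ln_p| |].
  - exists 0%nat. intros n _. discriminate.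
  - apply (is_lim_seq_plus _ _ p_infty 1);
      [apply is_lim_seq_INR|apply is_lim_seq_const|reflexivity].
Qed.

Lemma slow_div_lim f : slow f -> is_lim_seq (fun n => f n / (INR n + 1)) 0.
Proof.
  intros [C [r [HC H]]]. apply is_lim_seq_abs_0.
  (* The spare power of [plog] leaves a factor [/ plog n], which tends to 0. *)
  destruct (plog_pow_le_linear (S r)) as [K [HK HL]].
  apply (is_lim_seq_le_le (fun _ => 0) _ (fun n => C * K * / plog n)).
  - intros n. split; [apply Rabs_pos|]. pose proof (pos_INR n). pose proof (plog_ge1 n).
    unfold Rdiv. rewrite Rabs_mult, (Rabs_pos_eq (/ _)) by (left; apply Rinv_0_lt_compat; lra).
    apply Rmult_le_reg_r with ((INR n + 1) * plog n); [apply Rmult_lt_0_compat; lra|].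
    replace (Rabs (f n) * / (INR n + 1) * ((INR n + 1) * plog n)) with (Rabs (f n) * plog n)
      by (field; lra).
    replace (C * K * / plog n * ((INR n + 1) * plog n)) with (C * (K * (INR n + 1))) by (field; lra).
    apply Rle_trans with (C * plog n ^ r * plog n); [apply Rmult_le_compat_r; [lra|apply H]|].
    rewrite Rmult_assoc. apply Rmult_le_compat_l; [easy|].
    specialize (HL n). simpl in HL. lra.
  - apply is_lim_seq_const.
  - replace (Finite 0) with (Rbar_mult (C * K) 0) by (simpl; f_equal; ring).
    apply is_lim_seq_scal_l. apply (is_lim_seq_inv _ _ is_lim_seq_plog). discriminate.
Qed.

(** Comparison with a telescoping sum: for a = sqrt (n + 1) and b = sqrt (n + 2), 1/b^3 <= 2 (1/a -
    1/b). The majorant [w] stays below 4. *)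
Lemma ex_series_three_halves : ex_series (fun n => / ((INR n + 1) * sqrt (INR n + 1))).
Proof.
  set (w := fun n => 2 * (2 - / sqrt (INR n + 1))).
  assert (Hs : forall n, 1 <= sqrt (INR n + 1)).
  { intros n. rewrite <- sqrt_1 at 1. apply sqrt_le_1_alt. pose proof (pos_INR n); lra. }
  assert (Hle : forall n, rsum (S n) (fun n => / ((INR n + 1) * sqrt (INR n + 1))) <= w n).
  { induction n.
    - unfold w. simpl. replace (0 + 1) with 1 by ring. rewrite sqrt_1, Rmult_1_r, Rinv_1. lra.
    - cbn [rsum] in *. eapply Rle_trans; [apply Rplus_le_compat_r, IHn|].
      unfold w. rewrite S_INR.
      pose proof (Hs n) as H1. pose proof (Hs (S n)) as H2. rewrite S_INR in H2.
      pose proof (pos_INR n) as H0.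
      set (a := sqrt (INR n + 1)) in *. set (b := sqrt (INR n + 1 + 1)) in *.
      assert (Ha : a * a = INR n + 1) by (apply sqrt_sqrt; lra).
      assert (Hb : b * b = INR n + 1 + 1) by (apply sqrt_sqrt; lra).
      rewrite <- Hb.
      assert (Hab : a <= b) by (apply sqrt_le_1_alt; lra).
      assert (E : / (b * b * b) <= 2 * (/ a - / b)); [|lra].
      replace (2 * (/ a - / b)) with (2 * (b * b - a * a) / (a * b * (a + b)))
        by (field; repeat split; nra).
      replace (b * b - a * a) with 1 by lra.
      apply Rmult_le_reg_r with ((b * b * b) * (a * b * (a + b))).
      { repeat apply Rmult_lt_0_compat; lra. }
      replace (/ (b * b * b) * (b * b * b * (a * b * (a + b)))) with (a * b * (a + b))
        by (field; lra).
      replace (2 * 1 / (a * b * (a + b)) * (b * b * b * (a * b * (a + b)))) with (2 * (b * b * b))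
        by (field; repeat split; lra).
      assert (a * (a + b) <= 2 * (b * b)) by nra. nra. }
  assert (Hpos : forall n, 0 < / ((INR n + 1) * sqrt (INR n + 1))).
  { intros n. apply Rinv_0_lt_compat. pose proof (Hs n). pose proof (pos_INR n). nra. }
  destruct (ex_finite_lim_seq_incr
    (sum_n (fun n => / ((INR n + 1) * sqrt (INR n + 1)))) 4) as [l Hl].
  - intros n. rewrite !sum_n_rsum. specialize (Hpos (S n)). cbn [rsum] in *. lra.
  - intros n. rewrite sum_n_rsum. eapply Rle_trans; [apply Hle|]. unfold w.
    specialize (Hs n). assert (0 < / sqrt (INR n + 1)) by (apply Rinv_0_lt_compat; lra). lra.
  - exists l. exact Hl.
Qed.

Lemma slow_ex_series f g : slow g ->
  (forall n, Rabs (f n) <= Rabs (g n) / (INR n + 1) ^ 2) -> ex_series (fun n => Rabs (f n)).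
Proof.
  (* The linear bound on the exponent 2r gives, after a square root, [plog n ^ r] of order sqrt (n +
     1), which leaves the exponent 3/2. *)
  intros [C [r [HC H]]] Hf. destruct (plog_pow_le_linear (r + r)) as [K [HK HL]].
  apply (@ex_series_le R_AbsRing R_CompleteNormedModule _
    (fun n => C * sqrt K * / ((INR n + 1) * sqrt (INR n + 1)))).
  - intros n. change (norm (Rabs (f n))) with (Rabs (Rabs (f n))). rewrite Rabs_Rabsolu.
    eapply Rle_trans; [apply Hf|]. pose proof (pos_INR n).
    assert (HLr : plog n ^ r <= sqrt K * sqrt (INR n + 1)).
    { rewrite <- sqrt_mult by lra. apply Rsqr_incr_0_var; [|apply sqrt_pos].
      unfold Rsqr. rewrite sqrt_sqrt by nra. rewrite <- pow_add. apply HL. }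
    assert (Hq : 0 < sqrt (INR n + 1)) by (apply sqrt_lt_R0; lra).
    assert (Hq2 : sqrt (INR n + 1) * sqrt (INR n + 1) = INR n + 1) by (apply sqrt_sqrt; lra).
    apply Rle_trans with (C * (sqrt K * sqrt (INR n + 1)) / (INR n + 1) ^ 2).
    + apply Rmult_le_compat_r; [left; apply Rinv_0_lt_compat, pow_lt; lra|].
      eapply Rle_trans; [apply H|]. now apply Rmult_le_compat_l.
    + right. set (q := sqrt (INR n + 1)) in *. rewrite <- Hq2. field. lra.
  - apply (@ex_series_scal R_AbsRing R_NormedModule (C * sqrt K)), ex_series_three_halves.
Qed.

(** Bounded variation replaces the monotonicity in the Leibniz criterion, because the nested sums in
    the numerators grow. Summation by parts expresses twice the alternating sum through the
    absolutely convergent sum of differences. *)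
Lemma ex_series_alternating b : is_lim_seq b 0 ->
  ex_series (fun n => Rabs (b n - b (S n))) -> ex_series (fun n => (-1) ^ n * b n).
Proof.
  intros Hb Hd.
  assert (H : ex_series (fun n => (-1) ^ n * (b n - b (S n)))).
  { apply ex_series_Rabs. eapply ex_series_ext; [|exact Hd].
    intros n. simpl. rewrite Rabs_mult, pow_1_abs. ring. }
  destruct H as [l Hl]. apply is_series_rsum_inv in Hl.
  exists ((l + b 0%nat) / 2). apply is_series_rsum.
  assert (E : forall n, rsum n (fun n => (-1) ^ n * b n) =
    / 2 * (rsum n (fun n => (-1) ^ n * (b n - b (S n))) + b 0%nat - (-1) ^ n * b n)).
  { induction n; [simpl; field|]. cbn [rsum]. rewrite IHn. simpl. field. }
  eapply is_lim_seq_ext; [intros n; symmetry; apply E|].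
  replace ((l + b 0%nat) / 2) with (/ 2 * (l + b 0%nat - 0)) by field.
  apply (is_lim_seq_scal_l _ (/ 2) (l + b 0%nat - 0)).
  apply is_lim_seq_minus'; [apply is_lim_seq_plus'; [easy|apply is_lim_seq_const]|].
  apply is_lim_seq_abs_0. apply is_lim_seq_abs_0 in Hb.
  eapply is_lim_seq_ext; [|exact Hb]. intros n. simpl.
  now rewrite Rabs_mult, pow_1_abs, Rmult_1_l.
Qed.

(** * Iterated averages in place of logarithmic integrals *)

(** The half-line is an open neighbourhood of [0, 1] on which 1/(1 + u) is regular, so derivatives
    at both end points are two-sided. *)
Definition cont_dom (f : R -> R) : Prop := forall u, -1 < u -> continuous f u.

Lemma cont_dom_ex_RInt f a b : cont_dom f -> -1 < a -> -1 < b -> ex_RInt f a b.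
Proof.
  intros H Ha Hb. apply (@ex_RInt_continuous R_CompleteNormedModule). intros z [Hz _].
  apply H. eapply Rlt_le_trans; [|exact Hz]. now apply Rmin_glb_lt.
Qed.

Lemma cont_dom_is_derive_RInt f u : cont_dom f -> -1 < u ->
  is_derive (fun x => RInt f 0 x) u (f u).
Proof.
  intros H Hu. apply (is_derive_RInt f _ 0); [|now apply H].
  assert (Hd : 0 < u + 1) by lra.
  exists (mkposreal _ Hd). intros y Hy.
  apply (@RInt_correct R_CompleteNormedModule), cont_dom_ex_RInt; [easy|lra|].
  apply Rabs_lt_between in Hy. unfold minus, plus, opp in Hy; simpl in Hy. lra.
Qed.

(** The value at 0 is the limit of the averages of a continuous function; it keeps [avg f]
    continuous, so that averaging can be iterated. *)
Definition avg (f : R -> R) (u : R) : R :=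
  if Req_dec_T u 0 then f 0 else RInt f 0 u / u.

Lemma avg_0 f : avg f 0 = f 0.
Proof. unfold avg. destruct (Req_dec_T 0 0); lra. Qed.

Lemma avg_neq_0 f u : u <> 0 -> avg f u = RInt f 0 u / u.
Proof. unfold avg. destruct (Req_dec_T u 0); [contradiction|easy]. Qed.

(** At 0, continuity of the average is differentiability of the integral. *)
Lemma avg_cont f : cont_dom f -> cont_dom (avg f).
Proof.
  intros H u Hu. destruct (Req_dec_T u 0) as [->|Hu0].
  - pose proof (cont_dom_is_derive_RInt f 0 H Hu) as Hd. apply is_derive_Reals in Hd.
    apply continuity_pt_filterlim. intros eps Heps.
    destruct (Hd eps Heps) as [d Hd']. exists d. split; [apply cond_pos|].
    intros x [[_ Hx0] Hx]. simpl in Hx |- *. unfold R_dist in *. rewrite Rminus_0_r in Hx.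
    rewrite avg_0, avg_neq_0 by auto. specialize (Hd' x (not_eq_sym Hx0) Hx).
    rewrite Rplus_0_l in Hd'. rewrite (RInt_point (V := R_CompleteNormedModule)) in Hd'.
    unfold zero in Hd'; simpl in Hd'. now rewrite Rminus_0_r in Hd'.
  - apply (continuous_ext_loc _ (fun x => RInt f 0 x / x)).
    + assert (Hp : 0 < Rabs u) by now apply Rabs_pos_lt.
      exists (mkposreal _ Hp). intros y Hy. symmetry. apply avg_neq_0. intros ->.
      change (Rabs (0 - u) < Rabs u) in Hy. rewrite Rminus_0_l, Rabs_Ropp in Hy. lra.
    + apply (continuous_mult (K := R_AbsRing)).
      * apply (ex_derive_continuous (fun x => RInt f 0 x)). exists (f u).
        now apply cont_dom_is_derive_RInt.
      * apply (ex_derive_continuous (fun x => / x)). auto_derive. easy.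
Qed.

Lemma avg_le f g : cont_dom f -> cont_dom g -> (forall u, 0 <= u <= 1 -> f u <= g u) ->
  forall u, 0 <= u <= 1 -> avg f u <= avg g u.
Proof.
  intros Hf Hg H u Hu. destruct (Req_dec_T u 0) as [->|Hu0].
  - rewrite !avg_0. now apply H.
  - rewrite !avg_neq_0 by easy. apply Rmult_le_compat_r.
    + left. apply Rinv_0_lt_compat. lra.
    + apply RInt_le; [lra|apply cont_dom_ex_RInt; auto; lra..|].
      intros x Hx. apply H. lra.
Qed.

Lemma cont_dom_plus f g : cont_dom f -> cont_dom g -> cont_dom (fun u => f u + g u).
Proof. intros Hf Hg u Hu. apply (continuous_plus (V := R_NormedModule)); auto. Qed.

Lemma cont_dom_mult f g : cont_dom f -> cont_dom g -> cont_dom (fun u => f u * g u).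
Proof. intros Hf Hg u Hu. apply (continuous_mult (K := R_AbsRing)); auto. Qed.

Lemma cont_dom_const c : cont_dom (fun _ => c).
Proof. intros u _. apply continuous_const. Qed.

Lemma cont_dom_id : cont_dom (fun u => u).
Proof. intros u _. apply continuous_id. Qed.

Lemma cont_dom_pow f k : cont_dom f -> cont_dom (fun u => f u ^ k).
Proof.
  intros Hf. induction k; simpl; [apply cont_dom_const|now apply cont_dom_mult].
Qed.

Lemma cont_dom_inv f : cont_dom f -> (forall u, -1 < u -> f u <> 0) -> cont_dom (fun u => / f u).
Proof.
  intros Hf H0 u Hu. apply (continuous_comp f Rinv); auto.
  apply (ex_derive_continuous (fun x => / x)). auto_derive. now apply H0.
Qed.

Lemma cont_dom_rsum n f : (forall i, (i < n)%nat -> cont_dom (f i)) ->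
  cont_dom (fun u => rsum n (fun i => f i u)).
Proof.
  induction n; intros H; simpl; [apply cont_dom_const|]. apply cont_dom_plus; auto.
Qed.

Lemma avg_lin f g c : cont_dom f -> cont_dom g -> forall u, -1 < u ->
  avg (fun u => f u + c * g u) u = avg f u + c * avg g u.
Proof.
  intros Hf Hg u Hu. destruct (Req_dec_T u 0) as [->|Hu0].
  - now rewrite !avg_0.
  - rewrite !avg_neq_0 by easy.
    assert (E : RInt (fun u => f u + c * g u) 0 u = RInt f 0 u + c * RInt g 0 u).
    { assert (Ef : ex_RInt f 0 u) by (apply cont_dom_ex_RInt; auto; lra).
      assert (Eg : ex_RInt g 0 u) by (apply cont_dom_ex_RInt; auto; lra).
      etransitivity.
      - apply (RInt_plus (V := R_CompleteNormedModule)); [exact Ef|].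
        apply (ex_RInt_scal (V := R_NormedModule)). exact Eg.
      - apply (f_equal (Rplus (RInt f 0 u))).
        apply (RInt_scal (V := R_CompleteNormedModule)). exact Eg. }
    rewrite E. field. easy.
Qed.

(* [Lam (S s) f] is the integral over [0, 1] of [(- ln u)^s / s! * f u]; iterated averaging
   expresses it without improper integrals. *)
Fixpoint Lam (s : nat) (f : R -> R) : R :=
  match s with O => f 1 | S s' => Lam s' (avg f) end.

Lemma Lam_le s f g : cont_dom f -> cont_dom g -> (forall u, 0 <= u <= 1 -> f u <= g u) ->
  Lam s f <= Lam s g.
Proof.
  revert f g. induction s; intros f g Hf Hg H; simpl; [apply H; lra|].
  apply IHs; auto using avg_cont. now apply avg_le.
Qed.

Lemma Lam_ext s f g : cont_dom f -> cont_dom g -> (forall u, 0 <= u <= 1 -> f u = g u) ->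
  Lam s f = Lam s g.
Proof.
  intros Hf Hg H. apply Rle_antisym; apply Lam_le; auto; intros u Hu; rewrite H by easy; lra.
Qed.

Lemma Lam_lin s f g c : cont_dom f -> cont_dom g ->
  Lam s (fun u => f u + c * g u) = Lam s f + c * Lam s g.
Proof.
  revert f g. induction s; intros f g Hf Hg; simpl; [reflexivity|].
  rewrite <- IHs by auto using avg_cont.
  assert (Hc : cont_dom (fun u => f u + c * g u)).
  { apply cont_dom_plus; [easy|]. apply cont_dom_mult; [apply cont_dom_const|easy]. }
  apply Lam_ext; auto using avg_cont.
  - apply cont_dom_plus; [now apply avg_cont|].
    apply cont_dom_mult; [apply cont_dom_const|now apply avg_cont].
  - intros u Hu. apply avg_lin; auto; lra.
Qed.

Lemma Lam_zero s : Lam s (fun _ => 0) = 0.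
Proof.
  pose proof (Lam_lin s (fun _ => 0) (fun _ => 0) 1 (cont_dom_const 0) (cont_dom_const 0)) as H.
  cbv beta in H. rewrite (Lam_ext s (fun _ => 0 + 1 * 0) (fun _ => 0)) in H;
    [lra|apply cont_dom_const..|intros; ring].
Qed.

Lemma Lam_scal s f c : cont_dom f -> Lam s (fun u => c * f u) = c * Lam s f.
Proof.
  intros Hf. rewrite <- (Rplus_0_l (c * Lam s f)), <- (Lam_zero s).
  rewrite <- Lam_lin by auto using cont_dom_const.
  apply Lam_ext.
  - apply cont_dom_mult; [apply cont_dom_const|easy].
  - apply cont_dom_plus; [|apply cont_dom_mult]; auto using cont_dom_const.
  - intros; ring.
Qed.

Lemma Lam_plus s f g : cont_dom f -> cont_dom g ->
  Lam s (fun u => f u + g u) = Lam s f + Lam s g.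
Proof.
  intros Hf Hg. rewrite <- (Rmult_1_l (Lam s g)), <- Lam_lin by easy.
  apply Lam_ext; auto using cont_dom_plus; [|intros; ring].
  apply cont_dom_plus; [easy|apply cont_dom_mult; auto using cont_dom_const].
Qed.

Lemma Lam_rsum s n f : (forall i, (i < n)%nat -> cont_dom (f i)) ->
  Lam s (fun u => rsum n (fun i => f i u)) = rsum n (fun i => Lam s (f i)).
Proof.
  induction n; intros H; simpl; [apply Lam_zero|].
  rewrite Lam_plus by auto using cont_dom_rsum. rewrite IHn; auto.
Qed.

Lemma Lam_abs_le s f g : cont_dom f -> cont_dom g ->
  (forall u, 0 <= u <= 1 -> Rabs (f u) <= g u) -> Rabs (Lam s f) <= Lam s g.
Proof.
  intros Hf Hg H. apply Rabs_le. split.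
  - replace (- Lam s g) with (Lam s (fun u => -1 * g u)) by (rewrite Lam_scal by easy; ring).
    apply Lam_le; auto.
    + apply cont_dom_mult; auto using cont_dom_const.
    + intros u Hu. specialize (H u Hu). apply Rabs_le_between in H. lra.
  - apply Lam_le; auto. intros u Hu. specialize (H u Hu). apply Rabs_le_between in H. lra.
Qed.

(* Integration by parts: the weight [(- ln u)^s / s!] has derivative
   [- (1/u) (- ln u)^(s-1) / (s-1)!]. *)
Lemma Lam_deriv s f h : cont_dom f -> cont_dom h -> f 0 = h 0 ->
  (forall u, -1 < u -> is_derive (fun x => x * h x) u (f u)) -> Lam (S s) f = Lam s h.
Proof.
  intros Hf Hh H0 Hd. simpl. apply Lam_ext; auto using avg_cont.
  intros u Hu. destruct (Req_dec_T u 0) as [->|Hu0]; [now rewrite avg_0|].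
  rewrite avg_neq_0 by easy.
  assert (E : is_RInt f 0 u (minus (u * h u) (0 * h 0))).
  { apply (is_RInt_derive (fun x => x * h x)).
    - intros x Hx. apply Hd. rewrite Rmin_left in Hx by lra. lra.
    - intros x Hx. apply Hf. rewrite Rmin_left in Hx by lra. lra. }
  rewrite (is_RInt_unique _ _ _ _ E). unfold minus, plus, opp; simpl. field. easy.
Qed.

Lemma Lam_pow s k : Lam s (fun u => u ^ k) = / INR (S k) ^ s.
Proof.
  assert (Hk : INR (S k) <> 0) by (apply not_0_INR; lia).
  assert (Hc : cont_dom (fun u => u ^ k)) by apply cont_dom_pow, cont_dom_id.
  induction s; [simpl; rewrite pow1; field|].
  rewrite (Lam_deriv s _ (fun u => / INR (S k) * u ^ k)); auto.
  - rewrite Lam_scal, IHs by easy. rewrite <- tech_pow_Rmult. now rewrite Rinv_mult.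
  - apply cont_dom_mult; auto using cont_dom_const.
  - destruct k; [simpl; field|]. rewrite pow_i by lia. ring.
  - intros u Hu. apply (is_derive_ext (fun x => / INR (S k) * x ^ S k)).
    + intros t. simpl. ring.
    + auto_derive; [easy|]. change (/ INR (S k) * (1 * (INR (S k) * u ^ k)) = u ^ k).
      field. easy.
Qed.

Lemma is_lim_seq_bound (x e : nat -> R) (l : R) : (forall n, Rabs (x n - l) <= e n) ->
  is_lim_seq e 0 -> is_lim_seq x l.
Proof.
  intros H He.
  assert (Hd : is_lim_seq (fun n => x n - l) 0).
  { apply is_lim_seq_abs_0. apply (is_lim_seq_le_le (fun _ => 0) _ e); auto using is_lim_seq_const.
    intros n. split; [apply Rabs_pos|apply H]. }
  apply (is_lim_seq_ext (fun n => x n - l + l)); [intros; ring|].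
  replace (Finite l) with (Finite (0 + l)) by (f_equal; ring). apply is_lim_seq_plus'; [easy|apply is_lim_seq_const].
Qed.

Lemma inv_pow_le x s : 1 <= x -> / x ^ S s <= / x.
Proof.
  intros Hx. apply Rinv_le_contravar; [lra|].
  replace x with (x ^ 1) at 1 by ring. apply Rle_pow; [easy|lia].
Qed.

(** * The variable v = (1 - u)/(1 + u) and its moments *)

Definition cay (u : R) : R := (1 - u) / (1 + u).

Lemma cont_dom_inv_1p : cont_dom (fun u => / (1 + u)).
Proof.
  apply cont_dom_inv; [apply cont_dom_plus; [apply cont_dom_const|apply cont_dom_id]|].
  intros u Hu. lra.
Qed.

Lemma cont_dom_cay : cont_dom cay.
Proof.
  apply cont_dom_mult; [|apply cont_dom_inv_1p]. apply cont_dom_plus; [apply cont_dom_const|].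
  intros u Hu. apply (continuous_opp (V := R_NormedModule)), continuous_id.
Qed.

Lemma cay_bound u : 0 <= u <= 1 -> 0 <= cay u <= 1.
Proof.
  intros Hu. unfold cay. split.
  - apply Rmult_le_pos; [lra|]. left; apply Rinv_0_lt_compat; lra.
  - apply Rmult_le_reg_r with (1 + u); [lra|]. field_simplify; lra.
Qed.

(** This is (1 - v^(k+1))/u, written as a geometric sum to be regular at u = 0. It is the average of
    (k + 1) [moment_density k]. *)
Definition psi (k : nat) (u : R) : R := 2 * / (1 + u) * rsum (S k) (fun i => cay u ^ i).

Lemma cont_dom_psi k : cont_dom (psi k).
Proof.
  apply cont_dom_mult; [apply cont_dom_mult; [apply cont_dom_const|apply cont_dom_inv_1p]|].
  apply cont_dom_rsum. intros. apply cont_dom_pow, cont_dom_cay.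
Qed.

Lemma psi_S k u : psi (S k) u = psi k u + 2 * / (1 + u) * cay u ^ S k.
Proof. unfold psi. cbn [rsum]. ring. Qed.

Lemma psi_telescope k u : -1 < u -> u * psi k u = 1 - cay u ^ S k.
Proof.
  intros Hu. induction k.
  - unfold psi, cay. simpl. field. lra.
  - rewrite psi_S, Rmult_plus_distr_l, IHk. rewrite <- (tech_pow_Rmult _ (S k)).
    generalize (cay u ^ S k). intros x. unfold cay. field. lra.
Qed.

(** As 1 + v = 2/(1 + u), two consecutive terms of the sum merge into a multiple of a moment
    density. This is why the recursion advances by two and separates the parities. *)
Lemma psi_SS k u : -1 < u -> psi (S (S k)) u = psi k u + 4 * cay u ^ S k / (1 + u) ^ 2.
Proof.
  intros Hu. rewrite !psi_S. rewrite <- (tech_pow_Rmult _ (S k)).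
  generalize (cay u ^ S k). intros x. unfold cay. field. lra.
Qed.

Definition moment_density (k : nat) (u : R) : R := 2 * cay u ^ k * (/ (1 + u)) ^ 2.

Lemma cont_dom_moment_density k : cont_dom (moment_density k).
Proof.
  apply cont_dom_mult; [|apply cont_dom_pow, cont_dom_inv_1p].
  apply cont_dom_mult; [apply cont_dom_const|apply cont_dom_pow, cont_dom_cay].
Qed.

Lemma Lam_moment_density s k :
  Lam (S s) (moment_density k) = Lam s (psi k) / INR (S k).
Proof.
  assert (Hk : INR (S k) <> 0) by (apply not_0_INR; lia).
  enough (E : Lam (S s) (fun u => INR (S k) * moment_density k u) = Lam s (psi k)).
  { rewrite Lam_scal in E by apply cont_dom_moment_density. rewrite <- E. field. easy. }
  apply Lam_deriv.
  - apply cont_dom_mult; [apply cont_dom_const|apply cont_dom_moment_density].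
  - apply cont_dom_psi.
  - unfold moment_density, psi.
    assert (E : cay 0 = 1) by (unfold cay; field). rewrite E.
    rewrite (rsum_ext _ _ (fun _ => 1)) by (intros; apply pow1). rewrite pow1.
    assert (G : forall n, rsum n (fun _ => 1) = INR n).
    { induction n; [reflexivity|]. cbn [rsum]. now rewrite IHn, S_INR. }
    rewrite G. field.
  - intros u Hu. apply (is_derive_ext_loc (fun x => 1 - cay x ^ S k)).
    + assert (Hd : 0 < u + 1) by lra. exists (mkposreal _ Hd). intros y Hy.
      symmetry. apply psi_telescope.
      apply Rabs_lt_between in Hy. unfold minus, plus, opp in Hy; simpl in Hy. lra.
    + unfold cay at 1, moment_density. auto_derive; [lra|].
      change (match k with 0%nat => 1 | S _ => INR k + 1 end) with (INR (S k)).
      change ((1 + - u) * / (1 + u)) with (cay u).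
      generalize (cay u ^ k). intros x. field. lra.
Qed.

Lemma Lam_psi_0 k : Lam 0 (psi k) = 1.
Proof.
  simpl. unfold psi. replace (cay 1) with 0 by (unfold cay; field).
  rewrite rsum_head, rsum_0; [simpl; field|]. intros. apply pow_i. lia.
Qed.

(** The coefficients 2/(k + 2), with k of alternating parity, become the factors 2/(2 n_i - 1) and
    2/(2 n_i) of T_n. *)
Lemma Lam_psi_SS s k :
  Lam (S s) (psi (S (S k))) = Lam (S s) (psi k) + 2 / INR (S (S k)) * Lam s (psi (S k)).
Proof.
  transitivity (Lam (S s) (psi k) + 2 * Lam (S s) (moment_density (S k))).
  - rewrite <- Lam_lin by auto using cont_dom_psi, cont_dom_moment_density.
    apply Lam_ext; [apply cont_dom_psi| |].
    + apply cont_dom_plus; [apply cont_dom_psi|].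
      apply cont_dom_mult; [apply cont_dom_const|apply cont_dom_moment_density].
    + intros u Hu. rewrite psi_SS by lra. unfold moment_density. field. lra.
  - rewrite Lam_moment_density. field. apply not_0_INR; lia.
Qed.

Lemma Lam_psi_1 s : Lam (S s) (psi 1) = 2 * Lam s (psi 0).
Proof.
  transitivity (2 * Lam (S s) (moment_density 0)).
  - rewrite <- Lam_scal by apply cont_dom_moment_density.
    apply Lam_ext; [apply cont_dom_psi| |].
    + apply cont_dom_mult; [apply cont_dom_const|apply cont_dom_moment_density].
    + intros u Hu. unfold psi, moment_density, cay. simpl. field. lra.
  - rewrite Lam_moment_density. simpl. field.
Qed.

Lemma is_series_zetabar s : is_series (fun n => (-1) ^ n / INR (S n) ^ S s)
  (Lam (S s) (fun u => / (1 + u))).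
Proof.
  apply is_series_rsum.
  assert (Hc : forall k, cont_dom (fun u => (-1) ^ k * u ^ k)).
  { intros k. apply cont_dom_mult; [apply cont_dom_const|apply cont_dom_pow, cont_dom_id]. }
  apply (is_lim_seq_bound _ (fun n => 1 / (INR n + 1))); [|apply slow_div_lim, slow_const].
  intros n.
  set (g := fun u => rsum n (fun i => (-1) ^ i * u ^ i)).
  assert (Hg : cont_dom g) by (apply cont_dom_rsum; auto).
  replace (rsum n _) with (Lam (S s) g).
  2:{ unfold g. rewrite Lam_rsum by auto. apply rsum_ext. intros i _.
      rewrite Lam_scal by apply cont_dom_pow, cont_dom_id. now rewrite Lam_pow. }
  replace (Lam (S s) g - Lam (S s) (fun u => / (1 + u)))
    with (Lam (S s) (fun u => g u + -1 * / (1 + u))).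
  2:{ rewrite Lam_lin by auto using cont_dom_inv_1p. ring. }
  apply Rle_trans with (Lam (S s) (fun u => u ^ n)).
  - apply Lam_abs_le.
    + apply cont_dom_plus; [easy|].
      apply cont_dom_mult; [apply cont_dom_const|apply cont_dom_inv_1p].
    + apply cont_dom_pow, cont_dom_id.
    + intros u Hu.
      assert (E : g u = (1 - (-1) ^ n * u ^ n) / (1 + u)).
      { unfold g. induction n; simpl; [field; lra|]. rewrite IHn; [field; lra|].
        apply cont_dom_rsum; auto. }
      replace (g u + -1 * / (1 + u)) with (- ((-1) ^ n * u ^ n / (1 + u)))
        by (rewrite E; field; lra).
      unfold Rdiv. rewrite Rabs_Ropp, !Rabs_mult, pow_1_abs, Rmult_1_l.
      assert (0 <= u ^ n) by (apply pow_le; lra).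
      rewrite (Rabs_pos_eq (u ^ n)) by easy.
      rewrite (Rabs_pos_eq (/ _)) by (left; apply Rinv_0_lt_compat; lra).
      rewrite <- (Rmult_1_r (u ^ n)) at 2. apply Rmult_le_compat_l; [easy|].
      rewrite <- Rinv_1. apply Rinv_le_contravar; lra.
  - rewrite Lam_pow. unfold Rdiv. rewrite Rmult_1_l, <- S_INR. apply inv_pow_le.
    rewrite S_INR. pose proof (pos_INR n); lra.
Qed.

(** The convention zetabar(0) = 1/2 extends the formula to s = 0, where [Lam] is evaluation at u =
    1. *)
Lemma Lam_psi_zetabar s : Lam s (psi 0) = 2 * zetabar s.
Proof.
  destruct s; [rewrite Lam_psi_0; simpl; field|].
  unfold zetabar. rewrite (is_series_unique _ _ (is_series_zetabar s)).
  rewrite <- Lam_scal by apply cont_dom_inv_1p.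
  apply Lam_ext; [apply cont_dom_psi| |].
  - apply cont_dom_mult; [apply cont_dom_const|apply cont_dom_inv_1p].
  - intros u Hu. unfold psi. simpl. ring.
Qed.

(** * Moments in terms of T_n and zetabar *)

(* Reading [T_n({1}_{2a})] as a sum over chains [m_1 < ... < m_{2a} < 2n - 1] of integers of
   alternating parity, [te a n] is [T_{n+1}({1}_{2a})] and [od a n] is the analogous sum over
   chains of length [2a + 1] bounded by [2n + 1]. *)
Definition te (a n : nat) : R := Tsum a (S n).
Definition od (a n : nat) : R := rsum (S n) (fun i => 2 / (2 * INR i + 1) * te a i).

Lemma te_0 n : te 0 n = 1.
Proof. reflexivity. Qed.

Lemma te_S_0 a : te (S a) 0 = 0.
Proof. reflexivity. Qed.

Lemma od_0 a : od a 0 = 2 * te a 0.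
Proof. unfold od. simpl. field. Qed.

Lemma od_S a n : od a (S n) = od a n + 2 / (2 * INR n + 3) * te a (S n).
Proof.
  unfold od. cbn [rsum]. rewrite S_INR. do 3 f_equal. ring.
Qed.

(** The new chains are those whose last index equals n + 1; removing it leaves an arbitrary chain of
    odd length counted by [od a n]. *)
Lemma te_S_S a n : te (S a) (S n) = te (S a) n + od a n / (INR n + 1).
Proof.
  assert (E : forall n, te (S a) n = rsum n (fun i => rsum (n - i) (fun j =>
    te a i * 4 / ((2 * INR i + 1) * (2 * (INR i + 1 + INR j)))))).
  { clear n. intros n. unfold te. cbn [Tsum]. rewrite fsum_rsum.
    replace (S (S n - 1) - 1)%nat with n by lia. apply rsum_ext. intros i Hi.
    rewrite fsum_rsum. replace (S (S n - 1) - (1 + i))%nat with (n - i)%nat by lia.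
    apply rsum_ext. intros j Hj. change (1 + i)%nat with (S i).
    rewrite plus_INR, S_INR. f_equal. f_equal. ring. }
  rewrite !E. cbn [rsum].
  rewrite (rsum_ext n (fun i => rsum (S n - i) _) (fun i =>
    rsum (n - i) (fun j => te a i * 4 / ((2 * INR i + 1) * (2 * (INR i + 1 + INR j))))
    + / (INR n + 1) * (2 / (2 * INR i + 1) * te a i))).
  - rewrite rsum_plus, rsum_scal. replace (S n - n)%nat with 1%nat by lia.
    unfold od. cbn [rsum]. simpl (INR 0). pose proof (pos_INR n). field. lra.
  - intros i Hi. replace (S n - i)%nat with (S (n - i)) by lia. cbn [rsum]. f_equal.
    rewrite minus_INR by lia. pose proof (pos_INR n). pose proof (pos_INR i). field. lra.
Qed.

Definition zc (d : nat) : R := 2 * zetabar (2 * d).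

Lemma zc_0 : zc 0 = 1.
Proof. unfold zc. simpl. field. Qed.

(** Both sides obey the same recursion in n: [Lam_psi_SS] has the coefficient 2/(2n + 2) of [te_S_S]
    in the even case and 2/(2n + 3) of [od_S] in the odd case. Each parity feeds the other, so they
    are proved together; [Hodd] gets the odd statement from the even one at the same n and the odd
    one before it. *)
Lemma Lam_psi_conv n :
  (forall q, Lam (2 * q) (psi (2 * n)) = conv (fun b => te b n) zc q) /\
  (forall q, Lam (S (2 * q)) (psi (S (2 * n))) = conv (fun b => od b n) zc q).
Proof.
  assert (Hodd : forall n, (forall q, Lam (2 * q) (psi (2 * n)) = conv (fun b => te b n) zc q) ->
    (n = 0%nat \/ exists n', n = S n' /\
       forall q, Lam (S (2 * q)) (psi (S (2 * n'))) = conv (fun b => od b n') zc q) ->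
    forall q, Lam (S (2 * q)) (psi (S (2 * n))) = conv (fun b => od b n) zc q).
  { clear n. intros n He [->|[n' [-> Ho]]] q.
    - change (S (2 * 0)) with 1%nat. rewrite Lam_psi_1. specialize (He q). simpl (2 * 0)%nat in He.
      rewrite He. unfold conv. rewrite <- rsum_scal. apply rsum_ext. intros b _.
      rewrite od_0. ring.
    - replace (S (2 * S n')) with (S (S (S (2 * n')))) by lia. rewrite Lam_psi_SS, Ho.
      replace (S (S (2 * n'))) with (2 * S n')%nat by lia. rewrite He.
      unfold conv. rewrite <- rsum_scal, <- rsum_plus. apply rsum_ext. intros b _.
      rewrite od_S. replace (INR (S (2 * S n'))) with (2 * INR n' + 3); [ring|].
      rewrite S_INR, mult_INR, (S_INR n'). simpl. ring. }
  induction n as [|n [IHe IHo]].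
  - assert (He : forall q, Lam (2 * q) (psi (2 * 0)) = conv (fun b => te b 0) zc q).
    { intros q. change (2 * 0)%nat with 0%nat. rewrite Lam_psi_zetabar. unfold conv.
      rewrite rsum_head, rsum_0; [rewrite te_0, Nat.sub_0_r; unfold zc; ring|].
      intros i _. rewrite te_S_0. ring. }
    split; [exact He|]. apply Hodd; auto.
  - assert (He : forall q, Lam (2 * q) (psi (2 * S n)) = conv (fun b => te b (S n)) zc q).
    { intros [|q].
      - simpl (2 * 0)%nat. rewrite Lam_psi_0. unfold conv. simpl. rewrite te_0, zc_0. ring.
      - replace (2 * S n)%nat with (S (S (2 * n))) by lia.
        replace (2 * S q)%nat with (S (S (2 * q))) by lia.
        rewrite Lam_psi_SS. replace (S (S (2 * q))) with (2 * S q)%nat by lia.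
        rewrite IHe, IHo. unfold conv. rewrite 2 (rsum_head (S q)), !te_0, Rplus_assoc.
        f_equal. rewrite <- rsum_scal, <- rsum_plus. apply rsum_ext. intros b Hb.
        rewrite te_S_S. replace (S q - S b)%nat with (q - b)%nat by lia.
        replace (INR (S (S (2 * n)))) with (2 * (INR n + 1)).
        + pose proof (pos_INR n). field. lra.
        + rewrite !S_INR, mult_INR. simpl. ring. }
    split; [exact He|]. apply Hodd; eauto.
Qed.

Lemma slow_od_partial a : slow (te a) ->
  slow (fun n => rsum n (fun i => 2 / (2 * INR i + 1) * te a i)).
Proof.
  intros H. apply (slow_partial_sums _ (fun n => 2 * te a n)).
  - apply slow_mult; [apply slow_const|easy].
  - intros n. pose proof (pos_INR n). rewrite !Rabs_mult, (Rabs_pos_eq 2) by lra.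
    unfold Rdiv. rewrite Rabs_mult, (Rabs_pos_eq 2) by lra.
    rewrite Rabs_pos_eq by (left; apply Rinv_0_lt_compat; lra).
    rewrite (Rmult_assoc 2 (/ _)), (Rmult_assoc 2 (Rabs _)). apply Rmult_le_compat_l; [lra|].
    rewrite Rmult_comm. apply Rmult_le_compat_l; [apply Rabs_pos|].
    apply Rinv_le_contravar; lra.
Qed.

Lemma slow_od a : slow (te a) -> slow (od a).
Proof.
  intros H. unfold od. cbn [rsum]. apply slow_plus; [now apply slow_od_partial|].
  apply (slow_le _ (fun n => 2 * te a n)); [apply slow_mult; [apply slow_const|easy]|].
  intros n. rewrite !Rabs_mult. apply Rmult_le_compat_r; [apply Rabs_pos|].
  pose proof (pos_INR n).
  rewrite !Rabs_pos_eq; [|lra|apply Rmult_le_pos; [lra|left; apply Rinv_0_lt_compat; lra]].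
  apply Rmult_le_reg_r with (2 * INR n + 1); [lra|]. field_simplify; lra.
Qed.

Lemma slow_te a : slow (te a).
Proof.
  induction a; [apply (slow_const 1)|].
  apply (slow_le _ (fun n => rsum n (fun i => od a i / (INR i + 1)))).
  - apply (slow_partial_sums _ (od a)); [now apply slow_od|].
    intros n. pose proof (pos_INR n). unfold Rdiv.
    rewrite Rabs_mult, (Rabs_pos_eq (/ _)); [lra|left; apply Rinv_0_lt_compat; lra].
  - intros n. right. f_equal. induction n; [reflexivity|].
    rewrite te_S_S, IHn. reflexivity.
Qed.

(** * Expansion of powers of the arctangent with remainder *)

Definition atp (j : nat) (v : R) : R := (2 * atan v) ^ j / INR (fact j).

Lemma is_derive_atp j v : is_derive (atp (S j)) v (2 * (atp j v / (1 + v ^ 2))).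
Proof.
  unfold atp. rewrite fact_simpl, mult_INR.
  assert (INR (S j) <> 0) by (apply not_0_INR; lia). pose proof (INR_fact_neq_0 j) as Hf.
  revert Hf. generalize (INR (fact j)). intros y Hy. auto_derive; [easy|].
  change (match j with 0%nat => 1 | S _ => INR j + 1 end) with (INR (S j)). unfold Rsqr.
  field. repeat split; auto. nra.
Qed.

Lemma atp_S_0 j : atp (S j) 0 = 0.
Proof. unfold atp. rewrite atan_0, Rmult_0_r, pow_i by lia. unfold Rdiv. ring. Qed.

Lemma is_derive_rsum n (f : nat -> R -> R) (df : nat -> R) x :
  (forall i, (i < n)%nat -> is_derive (f i) x (df i)) ->
  is_derive (fun x => rsum n (fun i => f i x)) x (rsum n df).
Proof.
  induction n; intros H; simpl; [apply (is_derive_const (V := R_NormedModule))|].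
  apply (is_derive_plus (V := R_NormedModule)); auto.
Qed.

(** The mean value theorem is enough: the factor 1/(k + 1) that integration would gain is given
    up. *)
Lemma bound_of_derive_bound (F dF : R -> R) C k : F 0 = 0 -> 0 <= C ->
  (forall x, is_derive F x (dF x)) -> (forall x, 0 <= x <= 1 -> Rabs (dF x) <= C * x ^ k) ->
  forall x, 0 <= x <= 1 -> Rabs (F x) <= C * x ^ S k.
Proof.
  intros H0 HC Hd Hb x Hx.
  destruct (MVT_gen F 0 x dF) as [c [Hc E]].
  - intros; apply Hd.
  - intros y _. apply continuity_pt_filterlim, (ex_derive_continuous F). eexists; apply Hd.
  - rewrite Rmin_left, Rmax_right in Hc by lra.
    rewrite H0, !Rminus_0_r in E. rewrite E, Rabs_mult, (Rabs_pos_eq x) by lra.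
    simpl. rewrite (Rmult_comm x (x ^ k)), <- Rmult_assoc. apply Rmult_le_compat_r; [lra|].
    eapply Rle_trans; [apply Hb; lra|]. apply Rmult_le_compat_l; [easy|].
    apply pow_incr. lra.
Qed.

Lemma is_derive_monomial c k x :
  is_derive (fun x => c * x ^ S k) x (c * (INR (S k) * x ^ k)).
Proof.
  auto_derive; [easy|].
  change (match k with 0%nat => 1 | S _ => INR k + 1 end) with (INR (S k)). ring.
Qed.

(** Multiplying by 1 + v^2 takes differences of the coefficients up to sign, so the increments of
    [od] and one boundary term remain. *)
Lemma od_telescope a N v :
  (1 + v ^ 2) * rsum N (fun n => (-1) ^ n * od a n * v ^ S (2 * n)) =
  rsum N (fun n => (-1) ^ n * (2 / (2 * INR n + 1) * te a n) * v ^ S (2 * n))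
  - (-1) ^ N * rsum N (fun i => 2 / (2 * INR i + 1) * te a i) * v ^ S (2 * N).
Proof.
  induction N; [simpl; ring|]. cbn [rsum]. rewrite Rmult_plus_distr_l, IHN.
  unfold od. cbn [rsum]. replace (S (2 * S N)) with (S (2 * N) + 2)%nat by lia.
  rewrite pow_add. simpl ((-1) ^ S N). ring.
Qed.

Lemma te_telescope a N v :
  (1 + v ^ 2) * rsum N (fun n => (-1) ^ n * te (S a) n * v ^ (2 * n)) =
  - rsum N (fun n => (-1) ^ n * (od a n / (INR n + 1)) * v ^ S (S (2 * n)))
  - (-1) ^ N * te (S a) N * v ^ (2 * N).
Proof.
  induction N; [rewrite te_S_0; simpl; ring|]. cbn [rsum]. rewrite Rmult_plus_distr_l, IHN.
  rewrite te_S_S. replace (2 * S N)%nat with (S (S (2 * N))) by lia. simpl pow. ring.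
Qed.

Lemma Rabs_div_1p_sq x v : Rabs (x / (1 + v ^ 2)) <= Rabs x.
Proof.
  unfold Rdiv. pose proof (pow2_ge_0 v).
  rewrite Rabs_mult, (Rabs_pos_eq (/ _)) by (left; apply Rinv_0_lt_compat; lra).
  rewrite <- (Rmult_1_r (Rabs x)) at 2. apply Rmult_le_compat_l; [apply Rabs_pos|].
  rewrite <- Rinv_1. apply Rinv_le_contravar; lra.
Qed.

Lemma div_telescope X q g s T Y : q <> 0 -> q * s = T - Y ->
  (X + - g * T + g * Y) / q = X / q - g * s.
Proof. intros Hq E. replace T with (q * s + Y) by lra. field. easy. Qed.

Definition atp_remainder_even a N v :=
  atp (2 * a) v / (1 + v ^ 2) - (-1) ^ a * rsum N (fun n => (-1) ^ n * te a n * v ^ (2 * n)).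
Definition atp_remainder_odd a N v :=
  atp (S (2 * a)) v / (1 + v ^ 2)
  - (-1) ^ a * rsum N (fun n => (-1) ^ n * od a n * v ^ S (2 * n)).

(** Integrating the even remainder approximates [atp (S (2 * a))] itself, with the increments of
    [od] as coefficients. Dividing by 1 + v^2 cumulates them by [od_telescope]; the boundary term is
    the second summand of the new bound. *)
Lemma atp_remainder_odd_bound a D : slow D -> (forall N, 0 <= D N) ->
  (forall N v, 0 <= v <= 1 -> Rabs (atp_remainder_even a N v) <= D N * v ^ (2 * N)) ->
  exists D', slow D' /\ (forall N, 0 <= D' N) /\
  forall N v, 0 <= v <= 1 -> Rabs (atp_remainder_odd a N v) <= D' N * v ^ S (2 * N).
Proof.
  intros HD HD0 H.
  exists (fun N => 2 * D N + Rabs (rsum N (fun i => 2 / (2 * INR i + 1) * te a i))).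
  split; [|split].
  - apply slow_plus; [apply slow_mult; [apply slow_const|easy]|].
    eapply slow_le; [apply slow_od_partial, (slow_te a)|]. intros n. rewrite Rabs_Rabsolu. apply Rle_refl.
  - intros N. specialize (HD0 N). pose proof (Rabs_pos (rsum N (fun i => 2 / (2 * INR i + 1) * te a i))). lra.
  - intros N v Hv.
    set (F := fun v => atp (S (2 * a)) v +
      (- (-1) ^ a) * rsum N (fun n => (-1) ^ n * (2 / (2 * INR n + 1) * te a n) * v ^ S (2 * n))).
    assert (HF : Rabs (F v) <= 2 * D N * v ^ S (2 * N)).
    { apply (bound_of_derive_bound F (fun v => 2 * atp_remainder_even a N v)); auto.
      - unfold F. rewrite atp_S_0, rsum_0; [ring|]. intros i _. rewrite pow_i by lia. ring.
      - specialize (HD0 N). lra.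
      - intros x. unfold F, atp_remainder_even.
        replace (2 * (atp (2 * a) x / (1 + x ^ 2) - _)) with
          (2 * (atp (2 * a) x / (1 + x ^ 2)) + (- (-1) ^ a) *
            rsum N (fun n => (-1) ^ n * (2 / (2 * INR n + 1) * te a n) * (INR (S (2 * n)) * x ^ (2 * n)))).
        + apply (is_derive_plus (V := R_NormedModule)); [apply is_derive_atp|].
          apply is_derive_scal.
          apply (is_derive_rsum _ (fun n x => (-1) ^ n * (2 / (2 * INR n + 1) * te a n) * x ^ S (2 * n))).
          intros i _. apply is_derive_monomial.
        + rewrite (rsum_ext _ _ (fun n => 2 * ((-1) ^ n * te a n * x ^ (2 * n)))).
          * rewrite rsum_scal. ring.
          * intros n _. rewrite S_INR, mult_INR. simpl (INR 2). pose proof (pos_INR n).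
            field. lra.
      - intros x Hx. rewrite Rabs_mult, (Rabs_pos_eq 2), Rmult_assoc by lra.
        apply Rmult_le_compat_l; [lra|]. now apply H. }
    assert (Hq : 1 + v ^ 2 <> 0) by (pose proof (pow2_ge_0 v); lra).
    replace (atp_remainder_odd a N v) with
      ((F v + (-1) ^ a * (-1) ^ N * rsum N (fun i => 2 / (2 * INR i + 1) * te a i) * v ^ S (2 * N))
        / (1 + v ^ 2)).
    + eapply Rle_trans; [apply Rabs_div_1p_sq|]. eapply Rle_trans; [apply Rabs_triang|].
      rewrite Rmult_plus_distr_r. apply Rplus_le_compat; [easy|].
      rewrite !Rabs_mult, !pow_1_abs, !Rmult_1_l. apply Rmult_le_compat_l; [apply Rabs_pos|].
      rewrite Rabs_pos_eq by (apply pow_le; lra). lra.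
    + unfold atp_remainder_odd, F.
      rewrite <- (div_telescope _ _ _ _ _ _ Hq (od_telescope a N v)). f_equal. ring.
Qed.

(** The geometric series starts the induction, and each step integrates twice, through the odd
    remainder. The sign (-1)^a comes from the minus sign in [te_telescope]. Keeping the factor
    v^(2N) is essential: its moment supplies the decay 1/N. *)
Lemma atp_remainder_even_bound a : exists D, slow D /\ (forall N, 0 <= D N) /\
  forall N v, 0 <= v <= 1 -> Rabs (atp_remainder_even a N v) <= D N * v ^ (2 * N).
Proof.
  induction a as [|a [D [HD [HD0 H]]]].
  - exists (fun _ => 1). split; [apply slow_const|]. split; [intros; lra|]. intros N v Hv.
    unfold atp_remainder_even, atp. pose proof (pow2_ge_0 v).
    rewrite (rsum_ext _ _ (fun n => (- v ^ 2) ^ n)).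
    2:{ intros n _. rewrite te_0, Rmult_1_r, pow_mult, <- Rpow_mult_distr. f_equal. ring. }
    assert (E : forall N, rsum N (fun n => (- v ^ 2) ^ n) = (1 - (- v ^ 2) ^ N) / (1 + v ^ 2)).
    { induction N0; cbn [rsum]; [simpl; field; lra|]. rewrite IHN0.
      rewrite <- (tech_pow_Rmult (- v ^ 2) N0). field. lra. }
    rewrite E.
    replace (_ - _) with ((- v ^ 2) ^ N / (1 + v ^ 2)) by (simpl; field; lra).
    eapply Rle_trans; [apply Rabs_div_1p_sq|].
    rewrite <- RPow_abs, Rabs_Ropp, Rabs_pos_eq, pow_mult by lra. lra.
  - destruct (atp_remainder_odd_bound a D HD HD0 H) as [D' [HD' [HD0' H']]].
    exists (fun N => 2 * D' N + Rabs (te (S a) N)). split; [|split].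
    + apply slow_plus; [apply slow_mult; [apply slow_const|easy]|].
      eapply slow_le; [apply (slow_te (S a))|]. intros n. rewrite Rabs_Rabsolu. apply Rle_refl.
    + intros N. specialize (HD0' N). pose proof (Rabs_pos (te (S a) N)). lra.
    + intros N v Hv.
      set (F := fun v => atp (S (S (2 * a))) v +
        (- (-1) ^ a) * rsum N (fun n => (-1) ^ n * (od a n / (INR n + 1)) * v ^ S (S (2 * n)))).
      assert (HF : Rabs (F v) <= 2 * D' N * v ^ S (S (2 * N))).
      { apply (bound_of_derive_bound F (fun v => 2 * atp_remainder_odd a N v)); auto.
        - unfold F. rewrite atp_S_0, rsum_0; [ring|]. intros i _. rewrite pow_i by lia. ring.
        - specialize (HD0' N). lra.
        - intros x. unfold F, atp_remainder_odd.
          replace (2 * (atp (S (2 * a)) x / (1 + x ^ 2) - _)) with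
            (2 * (atp (S (2 * a)) x / (1 + x ^ 2)) + (- (-1) ^ a) *
              rsum N (fun n => (-1) ^ n * (od a n / (INR n + 1)) * (INR (S (S (2 * n))) * x ^ S (2 * n)))).
          + apply (is_derive_plus (V := R_NormedModule)); [apply is_derive_atp|].
            apply is_derive_scal.
            apply (is_derive_rsum _ (fun n x => (-1) ^ n * (od a n / (INR n + 1)) * x ^ S (S (2 * n)))).
            intros i _. apply is_derive_monomial.
          + rewrite (rsum_ext _ _ (fun n => 2 * ((-1) ^ n * od a n * x ^ S (2 * n)))).
            * rewrite rsum_scal. ring.
            * intros n _. rewrite !S_INR, mult_INR. simpl (INR 2). pose proof (pos_INR n).
              field. lra.
        - intros x Hx. rewrite Rabs_mult, (Rabs_pos_eq 2), Rmult_assoc by lra.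
          apply Rmult_le_compat_l; [lra|]. now apply H'. }
      assert (Hq : 1 + v ^ 2 <> 0) by (pose proof (pow2_ge_0 v); lra).
      replace (atp_remainder_even (S a) N v) with
        ((F v + (-1) ^ S a * (-1) ^ N * te (S a) N * v ^ (2 * N)) / (1 + v ^ 2)).
      * eapply Rle_trans; [apply Rabs_div_1p_sq|]. eapply Rle_trans; [apply Rabs_triang|].
        assert (Hp : 0 <= v ^ (2 * N)) by (apply pow_le; lra).
        rewrite Rmult_plus_distr_r. apply Rplus_le_compat.
        -- eapply Rle_trans; [exact HF|]. apply Rmult_le_compat_l; [specialize (HD0' N); lra|].
           change (v ^ S (S (2 * N))) with (v * (v * v ^ (2 * N))).
           assert (v * v <= 1) by nra. nra.
        -- rewrite !Rabs_mult, !pow_1_abs, !Rmult_1_l. apply Rmult_le_compat_l; [apply Rabs_pos|].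
           rewrite Rabs_pos_eq by easy. lra.
      * unfold atp_remainder_even, F.
        rewrite <- (div_telescope _ _ _ _ _ _ Hq (te_telescope a N v)). f_equal.
        replace (2 * S a)%nat with (S (S (2 * a))) by lia. rewrite <- (tech_pow_Rmult (-1) a). ring.
Qed.

(** * The alternating series of moments as an integral *)

(* [2 atan ((1 - u) / (1 + u)) = PI / 2 - 2 atan u] *)
Definition acay (j : nat) (u : R) : R := atp j (cay u).

Lemma cont_dom_acay j : cont_dom (acay j).
Proof.
  intros u Hu. apply (continuous_comp cay (atp j)); [now apply cont_dom_cay|].
  apply (ex_derive_continuous (atp j)). unfold atp. auto_derive. easy.
Qed.

Lemma cont_dom_inv_1p_sq : cont_dom (fun u => / (1 + u ^ 2)).
Proof.
  apply cont_dom_inv.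
  - apply cont_dom_plus; [apply cont_dom_const|apply cont_dom_pow, cont_dom_id].
  - intros u _. pose proof (pow2_ge_0 u). lra.
Qed.

Lemma cont_dom_acay_div j : cont_dom (fun u => acay j u / (1 + u ^ 2)).
Proof. apply cont_dom_mult; [apply cont_dom_acay|apply cont_dom_inv_1p_sq]. Qed.

(** A partial sum is the integral of a truncated expansion in v. The remainder bound is [D N] times
    the density of index 2N, so the error is controlled by [D N] times an already computed moment, a
    slow sequence over N. *)
Lemma is_series_te_moments a q :
  is_series (fun n => (-1) ^ n * te a n * (conv (fun b => te b n) zc q / (2 * INR n + 1)))
    ((-1) ^ a * Lam (S (2 * q)) (fun u => acay (2 * a) u / (1 + u ^ 2))).
Proof.
  destruct (atp_remainder_even_bound a) as [D [HD [HD0 H]]].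
  apply is_series_rsum.
  apply (is_lim_seq_bound _ (fun n => Rabs (D n * conv (fun b => te b n) zc q / (INR n + 1)))).
  2:{ apply (proj1 (is_lim_seq_abs_0 _)).
      apply (slow_div_lim (fun n => D n * conv (fun b => te b n) zc q)), slow_mult; [easy|].
      apply (slow_rsum (S q) (fun b n => te b n * zc (q - b))). intros b _.
      apply slow_mult; [apply slow_te|apply slow_const]. }
  intros N.
  set (h := fun n u => (-1) ^ n * te a n * moment_density (2 * n) u).
  assert (Hh : forall n, cont_dom (h n)).
  { intros n. apply cont_dom_mult; [apply cont_dom_const|apply cont_dom_moment_density]. }
  assert (HL : forall n, Lam (S (2 * q)) (moment_density (2 * n)) =
    conv (fun b => te b n) zc q / (2 * INR n + 1)).
  { intros n. rewrite Lam_moment_density, (proj1 (Lam_psi_conv n)).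
    rewrite S_INR, mult_INR. reflexivity. }
  rewrite (rsum_ext N _ (fun n => Lam (S (2 * q)) (h n))).
  2:{ intros n _. unfold h. rewrite Lam_scal by apply cont_dom_moment_density. now rewrite HL. }
  rewrite <- Lam_rsum by auto.
  match goal with |- Rabs ?x <= _ => replace x with
    (Lam (S (2 * q)) (fun u => rsum N (fun n => h n u) + (- (-1) ^ a) * (acay (2 * a) u / (1 + u ^ 2)))) end.
  2:{ rewrite Lam_lin; [ring|apply cont_dom_rsum; auto|apply cont_dom_acay_div]. }
  apply Rle_trans with (Lam (S (2 * q)) (fun u => D N * moment_density (2 * N) u)).
  - apply Lam_abs_le.
    + apply cont_dom_plus; [apply cont_dom_rsum; auto|].
      apply cont_dom_mult; [apply cont_dom_const|apply cont_dom_acay_div].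
    + apply cont_dom_mult; [apply cont_dom_const|apply cont_dom_moment_density].
    + intros u Hu. pose proof (cay_bound u Hu) as Hv. specialize (H N (cay u) Hv).
      assert (Hw : 0 <= 2 * (/ (1 + u)) ^ 2) by (pose proof (pow2_ge_0 (/ (1 + u))); lra).
      assert (E1 : rsum N (fun n => h n u) =
        2 * (/ (1 + u)) ^ 2 * rsum N (fun n => (-1) ^ n * te a n * cay u ^ (2 * n))).
      { rewrite <- rsum_scal. apply rsum_ext. intros n _. unfold h, moment_density. ring. }
      assert (E2 : acay (2 * a) u / (1 + u ^ 2) =
        2 * (/ (1 + u)) ^ 2 * (atp (2 * a) (cay u) / (1 + cay u ^ 2))).
      { unfold acay. generalize (atp (2 * a) (cay u)). intros x.
        assert (E : 1 + cay u ^ 2 = 2 * (1 + u ^ 2) / (1 + u) ^ 2) by (unfold cay; field; lra).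
        rewrite E. pose proof (pow2_ge_0 u). field. simpl. split; nra. }
      rewrite E1, E2.
      replace (_ + _) with (2 * (/ (1 + u)) ^ 2 * (- (-1) ^ a * atp_remainder_even a N (cay u))).
      * rewrite Rabs_mult, (Rabs_pos_eq _ Hw), Rabs_mult, Rabs_Ropp, pow_1_abs, Rmult_1_l.
        unfold moment_density.
        replace (D N * (2 * cay u ^ (2 * N) * (/ (1 + u)) ^ 2)) with
          (2 * (/ (1 + u)) ^ 2 * (D N * cay u ^ (2 * N))) by ring.
        now apply Rmult_le_compat_l.
      * unfold atp_remainder_even.
        assert (Hs : (-1) ^ a * (-1) ^ a = 1).
        { rewrite <- Rpow_mult_distr. replace (-1 * -1) with 1 by ring. apply pow1. }
        generalize (atp (2 * a) (cay u) / (1 + cay u ^ 2)).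
        generalize (rsum N (fun n => (-1) ^ n * te a n * cay u ^ (2 * n))). intros x y.
        transitivity (2 * (/ (1 + u)) ^ 2 * ((-1) ^ a * (-1) ^ a * x - (-1) ^ a * y)); [ring|].
        rewrite Hs. ring.
  - rewrite Lam_scal by apply cont_dom_moment_density. rewrite HL.
    eapply Rle_trans; [apply Rle_abs|]. pose proof (pos_INR N). unfold Rdiv.
    rewrite <- Rmult_assoc, !(Rabs_mult _ (/ _)).
    apply Rmult_le_compat_l; [apply Rabs_pos|].
    rewrite !Rabs_pos_eq by (left; apply Rinv_0_lt_compat; lra).
    apply Rinv_le_contravar; lra.
Qed.

(** * Expansion of the integral in powers of u *)

(* Coefficients of the expansion of [2 / (x - y)] in powers of [y]. *)
Definition geo (x : R) (t : nat) : R := 2 / x ^ S t.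

Definition qint (k j s : nat) : R := Lam (S s) (fun u => u ^ k * (acay j u / (1 + u ^ 2))).

Lemma is_derive_acay j u : -1 < u ->
  is_derive (acay (S j)) u (-2 * (acay j u / (1 + u ^ 2))).
Proof.
  intros Hu.
  assert (Hc : is_derive cay u (-2 / (1 + u) ^ 2)).
  { unfold cay. auto_derive; [lra|]. field. lra. }
  pose proof (is_derive_comp (atp (S j)) cay u _ _ (is_derive_atp j (cay u)) Hc) as H.
  replace (-2 * (acay j u / (1 + u ^ 2))) with
    (scal (-2 / (1 + u) ^ 2) (2 * (atp j (cay u) / (1 + cay u ^ 2)))); [exact H|].
  unfold scal; simpl. unfold mult; simpl. unfold acay.
  generalize (atp j (cay u)). intros x.
  assert (E : 1 + cay u * (cay u * 1) = 2 * (1 + u ^ 2) / (1 + u) ^ 2) by (unfold cay; field; lra).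
  rewrite E. pose proof (pow2_ge_0 u). simpl in *. field. split; lra.
Qed.

Lemma cont_dom_pow_acay k j : cont_dom (fun u => u ^ k * acay j u).
Proof. apply cont_dom_mult; [apply cont_dom_pow, cont_dom_id|apply cont_dom_acay]. Qed.

Lemma cont_dom_qint k j : cont_dom (fun u => u ^ k * (acay j u / (1 + u ^ 2))).
Proof. apply cont_dom_mult; [apply cont_dom_pow, cont_dom_id|apply cont_dom_acay_div]. Qed.

Lemma Lam_pow_acay_S s k j :
  INR (S k) * Lam (S s) (fun u => u ^ k * acay (S j) u) =
  Lam s (fun u => u ^ k * acay (S j) u) + 2 * qint (S k) j s.
Proof.
  assert (Hsc : cont_dom (fun u => INR (S k) * (u ^ k * acay (S j) u))).
  { apply cont_dom_mult; [apply cont_dom_const|apply cont_dom_pow_acay]. }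
  enough (E : Lam (S s) (fun u => INR (S k) * (u ^ k * acay (S j) u)
    + -2 * (u ^ S k * (acay j u / (1 + u ^ 2)))) = Lam s (fun u => u ^ k * acay (S j) u)).
  { rewrite Lam_lin in E; [|exact Hsc|apply cont_dom_qint].
    rewrite Lam_scal in E by apply cont_dom_pow_acay. fold (qint (S k) j s) in E. lra. }
  apply Lam_deriv.
  - apply cont_dom_plus; [exact Hsc|].
    apply cont_dom_mult; [apply cont_dom_const|apply cont_dom_qint].
  - apply cont_dom_pow_acay.
  - rewrite (pow_i (S k)) by lia. destruct k; [simpl; ring|]. rewrite pow_i by lia. ring.
  - intros u Hu. apply (is_derive_ext (fun x => x ^ S k * acay (S j) x)).
    + intros t. apply Rmult_assoc.
    + pose proof (is_derive_monomial 1 k u) as H1.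
      apply (is_derive_ext _ (fun x => x ^ S k)) in H1; [|intros; apply Rmult_1_l].
      pose proof (is_derive_mult (K := R_AbsRing) _ _ _ _ _ H1 (is_derive_acay j u Hu) Rmult_comm) as H.
      match type of H with is_derive _ _ ?d => replace (_ + _) with d; [exact H|] end.
      unfold plus, mult; simpl plus.
      change (match k with 0%nat => 1 | S _ => INR k + 1 end) with (INR (S k)).
      simpl. ring.
Qed.

(** Integration by parts is repeated until the logarithmic weight is used up. The last boundary term
    is [acay (S j) 1], which vanishes since [cay 1] is 0. *)
Lemma Lam_pow_acay s k j :
  Lam (S s) (fun u => u ^ k * acay (S j) u) = conv (geo (INR (S k))) (qint (S k) j) s.
Proof.
  assert (Hk : INR (S k) <> 0) by (apply not_0_INR; lia).
  induction s.
  - apply Rmult_eq_reg_l with (INR (S k)); [|easy]. rewrite Lam_pow_acay_S.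
    unfold conv, geo. cbn [rsum Nat.sub Lam]. unfold acay at 1.
    replace (cay 1) with 0 by (unfold cay; field). rewrite atp_S_0. field. easy.
  - apply Rmult_eq_reg_l with (INR (S k)); [|easy]. rewrite Lam_pow_acay_S, IHs.
    unfold conv. rewrite (rsum_head (S s)), Rmult_plus_distr_l, <- rsum_scal, Rplus_comm.
    f_equal.
    + unfold geo. rewrite Nat.sub_0_r. rewrite pow_1. field. easy.
    + apply rsum_ext. intros t _. simpl (S s - S t)%nat. unfold geo.
      rewrite <- (tech_pow_Rmult _ (S t)). field. split; [apply pow_nonzero|]; easy.
Qed.

(** One step of the geometric expansion of 1/(1 + u^2), keeping the remainder. *)
Lemma qint_shift k j s : qint k j s = - qint (S (S k)) j s + Lam (S s) (fun u => u ^ k * acay j u).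
Proof.
  enough (E : qint k j s + qint (S (S k)) j s = Lam (S s) (fun u => u ^ k * acay j u)) by lra.
  unfold qint. rewrite <- Lam_plus by apply cont_dom_qint.
  apply Lam_ext; [apply cont_dom_plus; apply cont_dom_qint|apply cont_dom_pow_acay|].
  intros u _. rewrite <- !(tech_pow_Rmult u (S k)), <- (tech_pow_Rmult u k).
  pose proof (pow2_ge_0 u). field. lra.
Qed.

Lemma qint_S k j s : qint k (S j) s = - qint (S (S k)) (S j) s + conv (geo (INR (S k))) (qint (S k) j) s.
Proof. now rewrite qint_shift, Lam_pow_acay. Qed.

Lemma qint_0 k s : qint k 0 s = - qint (S (S k)) 0 s + / 2 * geo (INR (S k)) s.
Proof.
  rewrite qint_shift. f_equal. rewrite (Lam_ext _ _ (fun u => u ^ k)).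
  - rewrite Lam_pow. unfold geo. field. apply pow_nonzero, not_0_INR. lia.
  - apply cont_dom_pow_acay.
  - apply cont_dom_pow, cont_dom_id.
  - intros u _. unfold acay, atp. simpl. field.
Qed.

Lemma acay_bound j u : 0 <= u <= 1 -> Rabs (acay j u) <= 2 ^ j.
Proof.
  intros Hu. pose proof (cay_bound u Hu) as [H0 H1]. unfold acay, atp.
  assert (Ha : 0 <= atan (cay u) <= PI / 4).
  { rewrite <- atan_0, <- atan_1. split.
    - destruct H0 as [H0|H0]; [left; now apply atan_increasing|right; now rewrite <- H0].
    - destruct H1 as [H1|H1]; [left; now apply atan_increasing|right; now rewrite H1]. }
  pose proof PI_4.
  assert (Hf : 1 <= INR (fact j)) by (apply (le_INR 1), lt_O_fact).
  unfold Rdiv. rewrite Rabs_mult, (Rabs_pos_eq (/ _)) by (left; apply Rinv_0_lt_compat; lra).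
  rewrite <- (Rmult_1_r (2 ^ j)). apply Rmult_le_compat; [apply Rabs_pos| | |].
  - left; apply Rinv_0_lt_compat; lra.
  - rewrite <- RPow_abs. apply pow_incr. split; [apply Rabs_pos|]. rewrite Rabs_pos_eq; lra.
  - rewrite <- Rinv_1. apply Rinv_le_contravar; lra.
Qed.

Lemma qint_bound k j s : Rabs (qint k j s) <= 2 ^ j / (INR k + 1).
Proof.
  apply Rle_trans with (Lam (S s) (fun u => 2 ^ j * u ^ k)).
  - apply Lam_abs_le; [apply cont_dom_qint| |].
    + apply cont_dom_mult; [apply cont_dom_const|apply cont_dom_pow, cont_dom_id].
    + intros u Hu. rewrite Rabs_mult, (Rabs_pos_eq (u ^ k)) by (apply pow_le; lra).
      rewrite Rmult_comm. apply Rmult_le_compat_r; [apply pow_le; lra|].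
      eapply Rle_trans; [apply Rabs_div_1p_sq|]. now apply acay_bound.
  - rewrite Lam_scal by apply cont_dom_pow, cont_dom_id. rewrite Lam_pow, <- S_INR.
    apply Rmult_le_compat_l; [apply pow_le; lra|]. apply inv_pow_le.
    rewrite S_INR. pose proof (pos_INR k). lra.
Qed.

(* [chain r t n] is the coefficient of [y^t] in the sum of
   [2^r / ((2 n_1 - 1 - y) ... (2 n_r - r - y))] over [0 < n_1 < ... < n_r <= n]. *)
Fixpoint chain (r t n : nat) : R :=
  match r with
  | O => match t with O => 1 | S _ => 0 end
  | S r' => rsum n (fun i => conv (fun t => chain r' t i) (geo (2 * INR i + 1 - INR r')) t)
  end.

Lemma conv_zero_l a b s : (forall t, a t = 0) -> conv a b s = 0.
Proof. intros H. apply rsum_0. intros t _. rewrite H. ring. Qed.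

Lemma conv_delta_l n b s : conv (fun t => chain 0 t n) b s = b s.
Proof.
  unfold conv. rewrite rsum_head, rsum_0.
  - simpl. rewrite Nat.sub_0_r. ring.
  - intros i _. simpl. ring.
Qed.

(** This also neutralises the factors 2n + 1 - r that may be zero or negative: they occur only for n
    < r, against a zero coefficient. For n >= r they are at least n + 1. *)
Lemma chain_lt r t n : (n < r)%nat -> chain r t n = 0.
Proof.
  revert t n. induction r; intros t n H; [lia|]. simpl. apply rsum_0. intros i Hi.
  apply conv_zero_l. intros t'. apply IHr. lia.
Qed.

Lemma chain_S_S r t n : chain (S r) t (S n) =
  chain (S r) t n + conv (fun t => chain r t n) (geo (2 * INR n + 1 - INR r)) t.
Proof. reflexivity. Qed.

Lemma chain_geo_bound r n t s : Rabs (chain r t n * geo (2 * INR n + 1 - INR r) s)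
  <= 2 * Rabs (chain r t n) / (INR n + 1).
Proof.
  destruct (Nat.lt_ge_cases n r) as [H|H].
  - rewrite chain_lt by easy. rewrite Rmult_0_l, Rabs_R0. unfold Rdiv. lra.
  - apply le_INR in H. pose proof (pos_INR n).
    assert (Hp : 0 < 2 * INR n + 1 - INR r) by lra.
    rewrite Rabs_mult. unfold geo, Rdiv.
    rewrite (Rabs_pos_eq (2 * _)).
    2:{ apply Rmult_le_pos; [lra|]. left. apply Rinv_0_lt_compat, pow_lt. lra. }
    rewrite <- Rmult_assoc, (Rmult_comm (Rabs _) 2).
    apply Rmult_le_compat_l; [pose proof (Rabs_pos (chain r t n)); lra|].
    eapply Rle_trans; [apply inv_pow_le; lra|]. apply Rinv_le_contravar; lra.
Qed.

Lemma slow_abs f : slow f -> slow (fun n => Rabs (f n)).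
Proof. intros H. apply (slow_le _ f); [easy|]. intros n. rewrite Rabs_Rabsolu. lra. Qed.

Lemma slow_chain r t : slow (chain r t).
Proof.
  revert t. induction r; intros t; [destruct t; apply slow_const|].
  apply (slow_partial_sums _ (fun n => rsum (S t) (fun j => 2 * Rabs (chain r j n)))).
  - apply (slow_rsum (S t) (fun j n => 2 * Rabs (chain r j n))). intros j _.
    apply slow_mult; [apply slow_const|apply slow_abs, IHr].
  - intros n. rewrite (Rabs_pos_eq (rsum _ _)).
    + unfold Rdiv. rewrite (Rmult_comm (rsum _ _)), <- rsum_scal.
      eapply Rle_trans; [apply rsum_abs|]. apply rsum_le. intros j _.
      eapply Rle_trans; [apply chain_geo_bound|]. unfold Rdiv. lra.
    + rewrite <- (rsum_0 (S t) (fun _ => 0)) at 1 by easy. apply rsum_le. intros j _.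
      pose proof (Rabs_pos (chain r j n)). lra.
Qed.

(** The next index of a chain either exceeds n + 1, which raises the power of u by 2 and flips the
    sign, or equals n + 1, which lengthens the chain. The natural subtractions are exact for n >= r,
    and otherwise every term is 0. *)
Lemma chain_qint_S r n j s : (r < j)%nat ->
  conv (fun t => chain r t n) (qint (2 * n - r) (j - r)) s =
  - conv (fun t => chain r t n) (qint (2 * S n - r) (j - r)) s
  + conv (conv (fun t => chain r t n) (geo (2 * INR n + 1 - INR r)))
      (qint (2 * S n - S r) (j - S r)) s.
Proof.
  intros Hr. destruct (Nat.lt_ge_cases n r) as [H|H].
  - rewrite !conv_zero_l; [ring|..]; intros t; try apply conv_zero_l; intros; now apply chain_lt.
  - rewrite conv_assoc.
    replace (- conv _ _ s) with (-1 * conv (fun t => chain r t n) (qint (2 * S n - r) (j - r)) s) by ring.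
    rewrite <- conv_scal_r, <- conv_plus_r. apply conv_ext; [easy|]. intros t _.
    replace (j - r)%nat with (S (j - S r)) by lia. rewrite qint_S.
    replace (S (S (2 * n - r))) with (2 * S n - r)%nat by lia.
    replace (INR (S (2 * n - r))) with (2 * INR n + 1 - INR r).
    2:{ rewrite S_INR, minus_INR, mult_INR by lia. simpl. ring. }
    replace (S (2 * n - r)) with (2 * S n - S r)%nat by lia. ring.
Qed.

Lemma chain_qint_0 r n s :
  conv (fun t => chain r t n) (qint (2 * n - r) 0) s =
  - conv (fun t => chain r t n) (qint (2 * S n - r) 0) s
  + / 2 * conv (fun t => chain r t n) (geo (2 * INR n + 1 - INR r)) s.
Proof.
  destruct (Nat.lt_ge_cases n r) as [H|H].
  - rewrite !conv_zero_l; [ring|..]; intros; now apply chain_lt.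
  - replace (- conv _ _ s) with (-1 * conv (fun t => chain r t n) (qint (2 * S n - r) 0) s) by ring.
    rewrite <- !conv_scal_r, <- conv_plus_r. apply conv_ext; [easy|]. intros t _.
    rewrite qint_0. replace (S (S (2 * n - r))) with (2 * S n - r)%nat by lia.
    replace (INR (S (2 * n - r))) with (2 * INR n + 1 - INR r); [ring|].
    rewrite S_INR, minus_INR, mult_INR by lia. simpl. ring.
Qed.

(* Truncating the expansion at [n_i <= n] leaves, for each incomplete chain, a [qint] integral. *)
Lemma qint_expansion d s n : qint 0 d s =
  rsum (S d) (fun i => (-1) ^ (n + i) * conv (fun t => chain i t n) (qint (2 * n - i) (d - i)) s)
  + rsum n (fun i => (-1) ^ (i + d) *
      (/ 2 * conv (fun t => chain d t i) (geo (2 * INR i + 1 - INR d)) s)).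
Proof.
  induction n.
  - rewrite rsum_head, rsum_0.
    + rewrite conv_delta_l. simpl. rewrite Nat.sub_0_r. ring.
    + intros i _. rewrite conv_zero_l; [ring|]. intros t. apply chain_lt. lia.
  - rewrite IHn. cbn [rsum]. rewrite (Rplus_comm (rsum n _) (_ * _)), <- Rplus_assoc. f_equal.
    (* [Y] collects the chains that skip the index n + 1 and [Z] those that take it; [Z i] joins
       [Y (S i)] in the coefficient of length i + 1 through [chain_S_S]. *)
    set (Y := fun i => conv (fun t => chain i t n) (qint (2 * S n - i) (d - i)) s).
    set (Z := fun i => conv (conv (fun t => chain i t n) (geo (2 * INR n + 1 - INR i)))
      (qint (2 * S n - S i) (d - S i)) s).
    rewrite (rsum_ext d _ (fun i => (-1) ^ (n + i) * Z i + -1 * ((-1) ^ (n + i) * Y i))).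
    2:{ intros i Hi. rewrite (chain_qint_S i n d s Hi). fold (Y i) (Z i). ring. }
    rewrite rsum_plus, rsum_scal.
    rewrite Nat.sub_diag, chain_qint_0.
    transitivity (rsum (S d) (fun i => (-1) ^ (S n + i) *
        conv (fun t => chain i t (S n)) (qint (2 * S n - i) (d - i)) s)
      + (-1) ^ (n + d) * (/ 2 * conv (fun t => chain d t n) (geo (2 * INR n + 1 - INR d)) s)).
    2:{ f_equal. cbn [rsum]. now rewrite Nat.sub_diag. }
    rewrite (rsum_head d). rewrite (rsum_ext d (fun i => (-1) ^ (S n + S i) * _)
      (fun i => (-1) ^ (n + i) * Z i + (-1) ^ (S n + S i) * Y (S i))).
    2:{ intros i Hi. replace (S n + S i)%nat with (S (S (n + i))) by lia. simpl pow.
        rewrite (conv_ext _ (fun t => chain (S i) t n +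
          conv (fun t => chain i t n) (geo (2 * INR n + 1 - INR i)) t) _ (qint (2 * S n - S i) (d - S i)))
          by (intros; first [apply chain_S_S|reflexivity]).
        rewrite conv_plus_l. fold (Y (S i)) (Z i). ring. }
    rewrite rsum_plus.
    assert (E : rsum (S d) (fun i => (-1) ^ (n + i) * Y i) =
      (-1) ^ (n + 0) * Y 0%nat + rsum d (fun i => (-1) ^ (n + S i) * Y (S i))) by apply rsum_head.
    rewrite (rsum_ext d (fun i => (-1) ^ (S n + S i) * _) (fun i => -1 * ((-1) ^ (n + S i) * Y (S i))))
      by (intros; simpl; ring).
    rewrite rsum_scal. cbn [rsum] in E.
    change (conv (fun t => chain 0 t (S n)) (qint (2 * S n - 0) (d - 0)) s) with (Y 0%nat).
    replace (conv (fun t => chain d t n) (qint (2 * S n - d) 0) s) with (Y d)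
      by (unfold Y; now rewrite Nat.sub_diag).
    change ((-1) ^ (S n + 0)) with (-1 * (-1) ^ (n + 0)). lra.
Qed.

(** The incomplete chains of [qint_expansion] carry a power of u of degree at least n, hence
    integrals of order 1/(n + 1) against slow coefficients. *)
Lemma is_series_chain d s :
  is_series (fun n => (-1) ^ (n + d) * conv (fun t => chain d t n) (geo (2 * INR n + 1 - INR d)) s)
    (2 * qint 0 d s).
Proof.
  apply is_series_rsum.
  apply (is_lim_seq_bound _ (fun n => Rabs (rsum (S d) (fun i => rsum (S s) (fun t =>
    2 * 2 ^ d * Rabs (chain i t n))) / (INR n + 1)))).
  2:{ apply (proj1 (is_lim_seq_abs_0 _)).
      apply (slow_div_lim (fun n => rsum (S d) (fun i => rsum (S s) (fun t => 2 * 2 ^ d * Rabs (chain i t n))))).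
      apply (slow_rsum (S d) (fun i n => rsum (S s) (fun t => 2 * 2 ^ d * Rabs (chain i t n)))). intros i _.
      apply (slow_rsum (S s) (fun t n => 2 * 2 ^ d * Rabs (chain i t n))). intros t _.
      apply slow_mult; [apply slow_const|apply slow_abs, slow_chain]. }
  intros n. rewrite (qint_expansion d s n). pose proof (pos_INR n) as Hn.
  rewrite (rsum_ext n (fun i => (-1) ^ (i + d) * (/ 2 * _)) (fun i => / 2 * ((-1) ^ (i + d) *
     conv (fun t => chain d t i) (geo (2 * INR i + 1 - INR d)) s))) by (intros; ring).
  rewrite rsum_scal.
  match goal with |- Rabs (?a - 2 * (?b + / 2 * ?a)) <= _ =>
    replace (a - 2 * (b + / 2 * a)) with (- (2 * b)) by field end.
  rewrite Rabs_Ropp, Rabs_mult, (Rabs_pos_eq 2) by lra.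
  eapply Rle_trans; [|apply Rle_abs].
  unfold Rdiv. rewrite (Rmult_comm (rsum _ _)), <- rsum_scal.
  eapply Rle_trans; [apply Rmult_le_compat_l; [lra|apply rsum_abs]|].
  rewrite <- rsum_scal. apply rsum_le. intros i Hi.
  rewrite Rabs_mult, pow_1_abs, Rmult_1_l.
  eapply Rle_trans; [apply Rmult_le_compat_l; [lra|apply rsum_abs]|].
  rewrite <- !rsum_scal. apply rsum_le. intros t Ht.
  destruct (Nat.lt_ge_cases n i) as [H|H].
  - rewrite chain_lt by easy. rewrite Rmult_0_l, Rabs_R0. lra.
  - rewrite Rabs_mult.
    assert (HQ : Rabs (qint (2 * n - i) (d - i) (s - t)) <= 2 ^ d * / (INR n + 1)).
    { eapply Rle_trans; [apply qint_bound|].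
      apply Rmult_le_compat; [apply pow_le; lra|left; apply Rinv_0_lt_compat; pose proof (pos_INR (2 * n - i)); lra| |].
      - apply Rle_pow; [lra|lia].
      - apply Rinv_le_contravar; [lra|]. apply Rplus_le_compat_r, le_INR. lia. }
    pose proof (Rabs_pos (chain i t n)). nra.
Qed.

(** * Sums over compositions *)

Lemma lsum_app l l' : lsum (l ++ l') = lsum l + lsum l'.
Proof. induction l; simpl; [ring|]. rewrite IHl. ring. Qed.

Lemma lsum_flat_map {A B : Type} (F : B -> R) (g : A -> list B) l :
  lsum (map F (flat_map g l)) = lsum (map (fun x => lsum (map F (g x))) l).
Proof. induction l; simpl; [reflexivity|]. now rewrite map_app, lsum_app, IHl. Qed.

Lemma lsum_filter {A : Type} (F : A -> R) (P : A -> bool) l :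
  lsum (map F (filter P l)) = lsum (map (fun x => if P x then F x else 0) l).
Proof. induction l as [|x l IH]; simpl; [reflexivity|]. destruct (P x); simpl; rewrite IH; ring. Qed.

Lemma lsum_ext_in {A : Type} (F G : A -> R) l : (forall x, In x l -> F x = G x) ->
  lsum (map F l) = lsum (map G l).
Proof. intros H. f_equal. now apply map_ext_in. Qed.

Lemma lsum_scal {A : Type} c (F : A -> R) l :
  lsum (map (fun x => c * F x) l) = c * lsum (map F l).
Proof. induction l; simpl; [ring|]. rewrite IHl. ring. Qed.

Lemma lsum_rsum {A : Type} n (F : nat -> A -> R) l :
  lsum (map (fun x => rsum n (fun i => F i x)) l) = rsum n (fun i => lsum (map (F i) l)).
Proof.
  induction l; simpl; [symmetry; now apply rsum_0|]. rewrite IHl. now rewrite <- rsum_plus.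
Qed.

Lemma lsum_permutation l l' : Permutation l l' -> lsum l = lsum l'.
Proof. induction 1; simpl; lra. Qed.

Lemma lsum_all_lists_S r B F : lsum (map F (all_lists (S r) B)) =
  rsum B (fun i => lsum (map (fun l => F (S i :: l)) (all_lists r B))).
Proof.
  simpl. rewrite lsum_flat_map, lsum_seq. apply rsum_ext. intros i _. now rewrite map_map.
Qed.

Lemma in_all_lists r B l :
  In l (all_lists r B) <-> length l = r /\ List.Forall (fun x => (1 <= x <= B)%nat) l.
Proof.
  revert l. induction r; intros l; simpl.
  - split.
    + intros [<-|[]]. auto.
    + intros [H _]. left. symmetry. now apply length_zero_iff_nil.
  - rewrite in_flat_map. split.
    + intros [x [Hx Hl]]. apply in_map_iff in Hl. destruct Hl as [l' [<- Hl']].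
      apply IHr in Hl'. apply in_seq in Hx. simpl. destruct Hl' as [<- Hl'].
      split; [reflexivity|]. constructor; [lia|easy].
    + intros [Hlen Hall]. destruct l as [|x l]; [discriminate|].
      inversion Hall; subst. exists x. split; [apply in_seq; lia|].
      apply in_map, IHr. split; [|easy]. now inversion Hlen.
Qed.

Lemma NoDup_all_lists r B : NoDup (all_lists r B).
Proof.
  induction r; simpl; [repeat constructor; auto|].
  generalize (seq_NoDup B 1). generalize (seq 1 B). intros s Hs.
  induction Hs as [|x s Hx Hs IH]; simpl; [constructor|].
  apply NoDup_app; [| easy |].
  - apply FinFun.Injective_map_NoDup; [|easy]. intros a b H. now inversion H.
  - intros l Hl Hl'. apply in_map_iff in Hl. destruct Hl as [a [<- _]].
    apply in_flat_map in Hl'. destruct Hl' as [y [Hy Hl']].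
    apply in_map_iff in Hl'. destruct Hl' as [c [E _]]. inversion E; subst. contradiction.
Qed.

Lemma nsum_ge_length l : List.Forall (fun x => (1 <= x)%nat) l -> (length l <= nsum l)%nat.
Proof. induction 1; simpl; lia. Qed.

Lemma in_all_lists_pos r B l : In l (all_lists r B) -> List.Forall (fun x => (1 <= x)%nat) l.
Proof.
  intros H. apply in_all_lists in H. destruct H as [_ H].
  eapply Forall_impl; [|exact H]. simpl. lia.
Qed.

(** The bound [B] on the entries is separate from the total [K] because the recursion on the length
    lowers the total inside a fixed box. *)
Definition csum (r B K : nat) (F : list nat -> R) : R :=
  lsum (map (fun l => if Nat.eqb (nsum l) K then F l else 0) (all_lists r B)).

Lemma csum_ext r B K F G :
  (forall l, length l = r -> List.Forall (fun x => (1 <= x)%nat) l -> F l = G l) ->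
  csum r B K F = csum r B K G.
Proof.
  intros H. apply lsum_ext_in. intros l Hl. rewrite H; auto.
  - now apply in_all_lists in Hl.
  - now apply in_all_lists_pos in Hl.
Qed.

Lemma csum_scal r B K c F : csum r B K (fun l => c * F l) = c * csum r B K F.
Proof.
  unfold csum. rewrite <- lsum_scal. apply lsum_ext_in. intros l _.
  destruct (Nat.eqb _ _); ring.
Qed.

Lemma csum_rsum r B K n F :
  csum r B K (fun l => rsum n (fun i => F i l)) = rsum n (fun i => csum r B K (F i)).
Proof.
  unfold csum. rewrite <- lsum_rsum. apply lsum_ext_in. intros l _.
  destruct (Nat.eqb _ _); [reflexivity|]. symmetry. now apply rsum_0.
Qed.

(** The total is written as length plus excess: a first entry 1 + j leaves the excess t - j, and j >
    t is impossible with positive entries. *)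
Lemma csum_S r B t F : (S r + t <= B)%nat ->
  csum (S r) B (S r + t) F =
  rsum (S t) (fun j => csum r B (r + (t - j)) (fun l => F (S j :: l))).
Proof.
  intros HB. unfold csum. rewrite lsum_all_lists_S.
  replace B with (S t + (B - S t))%nat at 1 by lia. rewrite rsum_app.
  rewrite (rsum_0 (B - S t)).
  - rewrite Rplus_0_r. apply rsum_ext. intros j Hj. apply lsum_ext_in. intros l _.
    change (nsum (S j :: l)) with (S j + nsum l)%nat.
    replace (Nat.eqb (S j + nsum l) (S r + t)) with (Nat.eqb (nsum l) (r + (t - j))); [reflexivity|].
    destruct (Nat.eqb_spec (nsum l) (r + (t - j))); symmetry; [apply Nat.eqb_eq|apply Nat.eqb_neq]; lia.
  - intros i Hi. rewrite (lsum_ext_in _ (fun _ => 0 * 0)).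
    + rewrite lsum_scal. ring.
    + intros l Hl. change (nsum (S (S t + i) :: l)) with (S (S t + i) + nsum l)%nat.
      assert (Hp := in_all_lists_pos _ _ _ Hl). apply in_all_lists in Hl.
      apply nsum_ge_length in Hp.
      replace (Nat.eqb (S (S t + i) + nsum l) (S r + t)) with false; [ring|].
      symmetry. apply Nat.eqb_neq. lia.
Qed.

Lemma Grev_S k l n : Grev (k :: l) (S n) =
  rsum n (fun i => Grev l (S i) * / (2 * INR i + 1 - INR (length l)) ^ k).
Proof.
  cbn [Grev]. rewrite fsum_rsum. replace (S (S n - 1) - 1)%nat with n by lia.
  apply rsum_ext. intros i _. change (length (k :: l)) with (S (length l)).
  change (1 + i)%nat with (S i). rewrite !S_INR. unfold Rdiv. do 3 f_equal. ring.
Qed.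

(** Expanding every factor 2/(x - y) geometrically, the coefficient of y^t collects the exponents
    k_i = 1 + t_i whose excesses t_i add up to t. *)
Lemma chain_csum r t n B : (r + t <= B)%nat ->
  chain r t n = 2 ^ r * csum r B (r + t) (fun l => Grev l (S n)).
Proof.
  revert t n. induction r; intros t n HB.
  - unfold csum. simpl. destruct t; simpl; ring.
  - rewrite csum_S by easy.
    transitivity (2 ^ S r * rsum (S t) (fun j => rsum n (fun i =>
      / (2 * INR i + 1 - INR r) ^ S j * csum r B (r + (t - j)) (fun l => Grev l (S i))))).
    + rewrite rsum_swap, <- rsum_scal. cbn [chain]. apply rsum_ext. intros i _.
      rewrite conv_comm. unfold conv. rewrite <- rsum_scal. apply rsum_ext. intros j Hj.
      rewrite IHr by lia. unfold geo. simpl (2 ^ S r). unfold Rdiv. ring.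
    + f_equal. apply rsum_ext. intros j _.
      rewrite (csum_ext _ _ _ _ (fun l => rsum n (fun i =>
         / (2 * INR i + 1 - INR r) ^ S j * Grev l (S i)))).
      * rewrite csum_rsum. apply rsum_ext. intros i _. now rewrite csum_scal.
      * intros l Hl _. rewrite Grev_S, Hl. apply rsum_ext. intros; ring.
Qed.

(** * Convergence of the series in W and their evaluation *)

Lemma Grev_lt l n : (n < length l)%nat -> Grev l (S n) = 0.
Proof.
  revert n. induction l as [|k l IH]; simpl length; intros n H; [lia|].
  rewrite Grev_S. apply rsum_0. intros i Hi. rewrite IH by lia. ring.
Qed.

Lemma Grev_div_bound l k n :
  Rabs (Grev l (S n) * / (2 * INR n + 1 - INR (length l)) ^ S k) <=
  Rabs (Grev l (S n)) / (INR n + 1) ^ S k.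
Proof.
  rewrite Rabs_mult. destruct (Nat.lt_ge_cases n (length l)) as [H|H].
  - rewrite Grev_lt by easy. rewrite Rabs_R0. unfold Rdiv. lra.
  - apply le_INR in H. pose proof (pos_INR n). apply Rmult_le_compat_l; [apply Rabs_pos|].
    rewrite Rabs_pos_eq by (left; apply Rinv_0_lt_compat, pow_lt; lra).
    apply Rinv_le_contravar; [apply pow_lt; lra|]. apply pow_incr. lra.
Qed.

Lemma div_pow_le x y k : 0 <= x -> 1 <= y -> x / y ^ S k <= x / y.
Proof. intros Hx Hy. apply Rmult_le_compat_l; [easy|]. now apply inv_pow_le. Qed.

Lemma slow_Grev l : List.Forall (fun x => (1 <= x)%nat) l -> slow (fun n => Grev l (S n)).
Proof.
  induction 1 as [|k l Hk Hl IH]; [apply (slow_const 1)|]. destruct k as [|k]; [lia|].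
  apply (slow_le _ (fun n => rsum n (fun i => Grev l (S i) * / (2 * INR i + 1 - INR (length l)) ^ S k))).
  - apply (slow_partial_sums _ (fun n => Grev l (S n))); [easy|]. intros n.
    eapply Rle_trans; [apply Grev_div_bound|]. apply div_pow_le; [apply Rabs_pos|].
    pose proof (pos_INR n); lra.
  - intros n. rewrite Grev_S. lra.
Qed.

(** Supplies the bounded variation needed when the outermost exponent is 1. *)
Lemma Grev_increment l : List.Forall (fun x => (1 <= x)%nat) l -> exists H, slow H /\
  forall n, Rabs (Grev l (S (S n)) - Grev l (S n)) <= Rabs (H n) / (INR n + 1).
Proof.
  intros Hl. destruct Hl as [|k l Hk Hl].
  - exists (fun _ => 0). split; [apply slow_const|]. intros n. simpl.
    rewrite Rminus_diag, Rabs_R0. unfold Rdiv. lra.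
  - destruct k as [|k]; [lia|]. exists (fun n => Grev l (S n)). split; [now apply slow_Grev|].
    intros n. rewrite !Grev_S. cbn [rsum].
    match goal with |- Rabs (?a + ?b - ?a) <= _ => replace (a + b - a) with b by ring end.
    eapply Rle_trans; [apply Grev_div_bound|]. apply div_pow_le; [apply Rabs_pos|].
    pose proof (pos_INR n); lra.
Qed.

(** [barT] is a [Series], meaningful only once convergence is known. An outermost exponent 1
    requires the alternating criterion; larger exponents converge absolutely. *)
Lemma ex_series_barT l k : List.Forall (fun x => (1 <= x)%nat) l ->
  ex_series (fun n => (-1) ^ n * (Grev l (S n) * / (2 * INR n + 1 - INR (length l)) ^ S k)).
Proof.
  intros Hl. pose proof (slow_Grev l Hl) as HG. destruct k.
  - destruct (Grev_increment l Hl) as [H [HH Hinc]].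
    set (b := fun n => Grev l (S n) * / (2 * INR n + 1 - INR (length l)) ^ 1).
    apply (ex_series_alternating b).
    + apply (is_lim_seq_bound _ (fun n => Rabs (Grev l (S n) / (INR n + 1)))).
      * intros n. rewrite Rminus_0_r. eapply Rle_trans; [apply Grev_div_bound|].
        pose proof (pos_INR n). unfold Rdiv. rewrite Rabs_mult, pow_1.
        rewrite (Rabs_pos_eq (/ _)); [lra|left; apply Rinv_0_lt_compat; lra].
      * apply (proj1 (is_lim_seq_abs_0 _)). now apply (slow_div_lim (fun n => Grev l (S n))).
    + apply (slow_ex_series _ (fun n => 2 * Rabs (Grev l (S n)) + Rabs (H n))).
      * apply slow_plus; [apply slow_mult; [apply slow_const|]|]; now apply slow_abs.
      * intros n. pose proof (pos_INR n) as Hn.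
        set (x := 2 * INR n + 1 - INR (length l)).
        (* A discrete product rule: the first part gains 2/(x (x + 2)) from the reciprocals, the
           second gains 1/(n + 1) from the increment of [Grev]. *)
        assert (Hb : b n - b (S n) = Grev l (S n) * (/ x - / (x + 2))
          - (Grev l (S (S n)) - Grev l (S n)) * / (x + 2)).
        { unfold b. rewrite !pow_1, S_INR. fold x.
          replace (2 * (INR n + 1) + 1 - INR (length l)) with (x + 2) by (unfold x; ring). ring. }
        rewrite Hb. rewrite (Rabs_pos_eq (2 * _ + _)).
        2:{ pose proof (Rabs_pos (Grev l (S n))). pose proof (Rabs_pos (H n)). lra. }
        unfold Rdiv. rewrite Rmult_plus_distr_r.
        eapply Rle_trans; [apply Rabs_triang|]. rewrite Rabs_Ropp. apply Rplus_le_compat.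
        -- destruct (Nat.lt_ge_cases n (length l)) as [H1|H1].
           ++ rewrite Grev_lt by easy. rewrite Rmult_0_l, Rabs_R0. lra.
           ++ apply le_INR in H1. assert (Hx : INR n + 1 <= x) by (unfold x; lra).
              rewrite Rabs_mult, (Rmult_comm 2), Rmult_assoc.
              apply Rmult_le_compat_l; [apply Rabs_pos|].
              replace (/ x - / (x + 2)) with (2 * / (x * (x + 2))) by (field; lra).
              rewrite Rabs_pos_eq.
              ** apply Rmult_le_compat_l; [lra|]. apply Rinv_le_contravar; [apply pow_lt; lra|].
                 simpl. nra.
              ** apply Rmult_le_pos; [lra|]. left. apply Rinv_0_lt_compat. nra.
        -- destruct (Nat.lt_ge_cases (S n) (length l)) as [H1|H1].
           ++ rewrite !Grev_lt by lia. rewrite Rminus_diag, Rmult_0_l, Rabs_R0.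
              apply Rmult_le_pos; [apply Rabs_pos|]. left. apply Rinv_0_lt_compat, pow_lt. lra.
           ++ apply le_INR in H1. rewrite S_INR in H1.
              assert (Hx : INR n + 1 <= x + 2) by (unfold x; lra).
              rewrite Rabs_mult.
              replace (Rabs (H n) * / (INR n + 1) ^ 2) with (Rabs (H n) / (INR n + 1) * / (INR n + 1))
                by (field; lra).
              apply Rmult_le_compat; [apply Rabs_pos|apply Rabs_pos|apply Hinc|].
              rewrite Rabs_pos_eq by (left; apply Rinv_0_lt_compat; lra).
              apply Rinv_le_contravar; lra.
  - apply ex_series_Rabs. eapply (slow_ex_series _ _ HG). intros n.
    rewrite Rabs_mult, pow_1_abs, Rmult_1_l. eapply Rle_trans; [apply Grev_div_bound|].
    apply Rmult_le_compat_l; [apply Rabs_pos|]. pose proof (pos_INR n).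
    apply Rinv_le_contravar; [apply pow_lt; lra|]. apply Rle_pow; [lra|lia].
Qed.

Lemma is_series_Rscal (c : R) (a : nat -> R) (l : R) :
  is_series a l -> is_series (fun n => c * a n) (c * l).
Proof. exact (is_series_scal (K := R_AbsRing) (V := R_NormedModule) c a l). Qed.

Definition barT_term (ks : list nat) (n : nat) : R :=
  match ks with
  | nil => 0
  | k :: l => 2 ^ S (length l) * ((-1) ^ S n *
      (Grev l (S n) * / (2 * INR n + 1 - INR (length l)) ^ k))
  end.

Lemma is_series_barT ks : ks <> nil -> List.Forall (fun x => (1 <= x)%nat) ks ->
  is_series (barT_term ks) (barT (rev ks)).
Proof.
  intros Hnil Hks. destruct Hks as [|k l Hk Hl]; [contradiction|]. destruct k as [|k]; [lia|].
  unfold barT. rewrite rev_involutive, length_rev. cbn [barT_term].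
  change (length (S k :: l)) with (S (length l)).
  apply is_series_Rscal.
  destruct (ex_series_barT l k Hl) as [s Hs].
  assert (H : is_series (fun n => (-1) ^ S n *
    (Grev l (S n) * / (2 * INR n + 1 - INR (length l)) ^ S k)) (-1 * s)).
  { apply (is_series_ext (fun n => -1 * ((-1) ^ n *
      (Grev l (S n) * / (2 * INR n + 1 - INR (length l)) ^ S k)))).
    - intros n. symmetry. apply Rmult_assoc.
    - now apply is_series_Rscal. }
  rewrite (Series_ext _ (fun n => (-1) ^ S n *
    (Grev l (S n) * / (2 * INR n + 1 - INR (length l)) ^ S k))).
  - rewrite (is_series_unique _ _ H). exact H.
  - intros n. cbv zeta. rewrite !S_INR. unfold Rdiv.
    replace (2 * (INR n + 1) - (INR (length l) + 1)) with (2 * INR n + 1 - INR (length l)) by ring.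
    ring.
Qed.

Lemma is_series_lsum {A : Type} (F : A -> nat -> R) (s : A -> R) l :
  (forall x, In x l -> is_series (F x) (s x)) ->
  is_series (fun n => lsum (map (fun x => F x n) l)) (lsum (map s l)).
Proof.
  induction l; intros H.
  - apply is_series_rsum. apply (is_lim_seq_ext (fun _ => 0)); [|apply is_lim_seq_const].
    intros n. symmetry. now apply rsum_0.
  - simpl. apply (is_series_plus (K := R_AbsRing) (V := R_NormedModule)); [|apply IHl]; intros; apply H; simpl; auto.
Qed.

(** Reversal permutes the compositions of k, so tuples may be read from the last exponent, the order
    in which [Grev] and [chain] recurse. *)
Lemma W_rev k r : W k r = csum r k k (fun ks => barT (rev ks)).
Proof.
  unfold W, csum. rewrite <- lsum_filter.
  set (P := fun ks => Nat.eqb (nsum ks) k).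
  rewrite <- (map_map (@rev nat) barT). apply lsum_permutation, Permutation_map.
  assert (Hn : forall l, nsum (rev l) = nsum l).
  { assert (Happ : forall l l', nsum (l ++ l') = (nsum l + nsum l')%nat).
    { induction l; intros; simpl; [reflexivity|]. rewrite IHl. lia. }
    induction l; simpl; [reflexivity|]. rewrite Happ, IHl. simpl. lia. }
  assert (Hrev : forall l, In l (filter P (all_lists r k)) -> In (rev l) (filter P (all_lists r k))).
  { intros l Hl. apply filter_In in Hl. destruct Hl as [Hl HP]. apply filter_In.
    split; [|unfold P in *; now rewrite Hn].
    apply in_all_lists in Hl. apply in_all_lists. rewrite length_rev.
    split; [easy|]. now apply Forall_rev. }
  apply NoDup_Permutation.
  - apply NoDup_filter, NoDup_all_lists.
  - apply FinFun.Injective_map_NoDup; [|apply NoDup_filter, NoDup_all_lists].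
    intros a b E. rewrite <- (rev_involutive a), E. apply rev_involutive.
  - intros l. rewrite in_map_iff. split.
    + intros Hl. exists (rev l). split; [apply rev_involutive|now apply Hrev].
    + intros [l' [<- Hl']]. now apply Hrev.
Qed.

(** The same series is summed twice, as a finite sum of the series [barT] and by [is_series_chain],
    and the two sums must agree. *)
Lemma W_qint d s : W (S d + s) (S d) = (-1) ^ S d * (2 * qint 0 d s).
Proof.
  set (K := (S d + s)%nat). rewrite W_rev.
  assert (H1 : is_series (fun n => csum (S d) K K (fun ks => barT_term ks n))
    (csum (S d) K K (fun ks => barT (rev ks)))).
  { unfold csum. rewrite <- lsum_filter.
    apply (is_series_ext (fun n => lsum (map (fun ks => barT_term ks n)
      (filter (fun l => Nat.eqb (nsum l) K) (all_lists (S d) K))))).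
    { intros n. now rewrite <- lsum_filter. }
    apply is_series_lsum. intros ks Hks. apply filter_In in Hks. destruct Hks as [Hks _].
    apply is_series_barT; [|now apply in_all_lists_pos in Hks].
    intros ->. apply in_all_lists in Hks. now destruct Hks. }
  assert (H2 : is_series (fun n => csum (S d) K K (fun ks => barT_term ks n))
    ((-1) ^ S d * (2 * qint 0 d s))).
  { apply (is_series_ext (fun n => (-1) ^ S d * ((-1) ^ (n + d) *
      conv (fun t => chain d t n) (geo (2 * INR n + 1 - INR d)) s))).
    2:{ apply is_series_Rscal, is_series_chain. }
    intros n. unfold K. rewrite csum_S by lia.
    rewrite conv_comm. unfold conv. rewrite <- Rmult_assoc, <- rsum_scal. apply rsum_ext.
    intros j Hj. rewrite (csum_ext _ _ _ _ (fun l => (-1) ^ S n * (2 ^ S d *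
      / (2 * INR n + 1 - INR d) ^ S j) * Grev l (S n))).
    - rewrite csum_scal, (chain_csum d (s - j) n K) by (unfold K; lia). fold K.
      assert (Hs : (-1) ^ d * (-1) ^ d = 1).
      { rewrite <- Rpow_mult_distr. replace (-1 * -1) with 1 by ring. apply pow1. }
      unfold geo, Rdiv. rewrite pow_add, <- !(tech_pow_Rmult (-1)), <- (tech_pow_Rmult 2).
      generalize (csum d K (d + (s - j)) (fun l => Grev l (S n))). intros c.
      generalize (/ (2 * INR n + 1 - INR d) ^ S j). intros y.
      transitivity (((-1) ^ d * (-1) ^ d) * (-1 * (-1) ^ n * 2 ^ d * 2 * y * c)); [ring|].
      rewrite Hs. ring.
    - intros l Hl _. cbn [barT_term]. rewrite Hl. ring. }
  now rewrite <- (is_series_unique _ _ H1), (is_series_unique _ _ H2).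
Qed.

(** * The numbers Z(j, p) as an inverse matrix *)

Lemma last_cons (x d : nat) l : last (x :: l) d = last l x.
Proof.
  revert x d. induction l as [|y l IH]; intros x d; [reflexivity|].
  change (last (x :: y :: l) d) with (last (y :: l) d). now rewrite !IH.
Qed.

Lemma rsum_single n c f : (c < n)%nat ->
  rsum n (fun i => if Nat.eqb c i then f i else 0) = f c.
Proof.
  induction n; intros H; [lia|]. cbn [rsum]. destruct (Nat.eq_dec c n) as [->|Hc].
  - rewrite Nat.eqb_refl, rsum_0; [ring|]. intros i Hi.
    destruct (Nat.eqb_spec n i); [lia|reflexivity].
  - rewrite IHn by lia. destruct (Nat.eqb_spec c n); [lia|ring].
Qed.

Definition zchain (p k j : nat) : R :=
  lsum (map (fun l => prod_diffs (fun d => zetabar (2 * d)) (j :: l))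
    (filter (fun l => andb (incr (j :: l)) (Nat.eqb (last l j) p)) (all_lists k p))).

Lemma zchain_0 p j : zchain p 0 j = if Nat.eqb j p then 1 else 0.
Proof.
  unfold zchain. rewrite lsum_filter. simpl. destruct (Nat.eqb j p); simpl; ring.
Qed.

Lemma zchain_S p k j : zchain p (S k) j =
  rsum p (fun i => if Nat.ltb j (S i) then zetabar (2 * (S i - j)) * zchain p k (S i) else 0).
Proof.
  unfold zchain at 1. rewrite lsum_filter, lsum_all_lists_S. apply rsum_ext. intros i _.
  unfold zchain. rewrite lsum_filter. destruct (Nat.ltb j (S i)) eqn:Hj.
  - rewrite <- lsum_scal. apply lsum_ext_in. intros l _. rewrite last_cons.
    change (incr (j :: S i :: l)) with (andb (Nat.ltb j (S i)) (incr (S i :: l))). rewrite Hj.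
    cbn [andb]. destruct (andb _ _); [reflexivity|ring].
  - rewrite (lsum_ext_in _ (fun _ => 0 * 0)); [rewrite lsum_scal; ring|]. intros l _.
    change (incr (j :: S i :: l)) with (andb (Nat.ltb j (S i)) (incr (S i :: l))). rewrite Hj.
    simpl. ring.
Qed.

Lemma zchain_gt p k j : (p < j + k)%nat -> zchain p k j = 0.
Proof.
  revert j. induction k; intros j H.
  - rewrite zchain_0. destruct (Nat.eqb_spec j p); [lia|reflexivity].
  - rewrite zchain_S. apply rsum_0. intros i Hi. destruct (Nat.ltb_spec j (S i)); [|reflexivity].
    rewrite IHk by lia. ring.
Qed.

(** Chains of length 0 account for the separate value Z(p, p) = 1, and chains longer than p - j do
    not exist. The free bound n lets [Zc_rec] use two different ranges. *)
Lemma Zc_zchain j p n : (j <= p)%nat -> (p - j < n)%nat ->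
  Zc j p = rsum n (fun k => (-2) ^ k * zchain p k j).
Proof.
  intros Hj Hn. replace n with (S (p - j) + (n - S (p - j)))%nat by lia.
  rewrite rsum_app, (rsum_0 (n - _)).
  2:{ intros i _. rewrite zchain_gt by lia. ring. }
  rewrite Rplus_0_r, rsum_head, zchain_0. unfold Zc. destruct (Nat.eqb_spec j p) as [->|Hne].
  - rewrite Nat.sub_diag. simpl. ring.
  - rewrite fsum_rsum. replace (S (p - j) - 1)%nat with (p - j)%nat by lia.
    rewrite Rmult_0_r, Rplus_0_l. reflexivity.
Qed.

(** Splitting off the first step of a chain gives the factor -2 zetabar(2(i - j)), which is
    [- zc (i - j)]. *)
Lemma Zc_rec p j : (j <= p)%nat ->
  Zc j p + rsum p (fun i => if Nat.ltb j (S i) then zc (S i - j) * Zc (S i) p else 0) =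
  if Nat.eqb j p then 1 else 0.
Proof.
  intros Hj. rewrite (Zc_zchain j p (S p)) by lia. rewrite rsum_head, zchain_0.
  rewrite (rsum_ext p (fun i => (-2) ^ S i * _) (fun k => rsum p (fun i =>
    if Nat.ltb j (S i) then -1 * zc (S i - j) * ((-2) ^ k * zchain p k (S i)) else 0))).
  2:{ intros k _. rewrite zchain_S, <- rsum_scal. apply rsum_ext. intros i _.
      destruct (Nat.ltb j (S i)); [|ring]. unfold zc. simpl ((-2) ^ S k). ring. }
  rewrite rsum_swap, Rplus_assoc, <- rsum_plus, rsum_0; [simpl; ring|].
  intros i Hi. destruct (Nat.ltb j (S i)).
  - rewrite rsum_scal, (Zc_zchain (S i) p p) by lia. ring.
  - rewrite rsum_0 by easy. ring.
Qed.

(** The matrix with entries [zc (q - c)] is triangular with unit diagonal, as zetabar(0) = 1/2; the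
    recursion says that Z inverts it. *)
Lemma Zc_inverse b c : (c <= b)%nat ->
  rsum (S b) (fun q => if Nat.leb c q then zc (q - c) * Zc (S q) (S b) else 0) =
  if Nat.eqb c b then 1 else 0.
Proof.
  intros Hc. change (Nat.eqb c b) with (Nat.eqb (S c) (S b)). rewrite <- (Zc_rec (S b) (S c)) by lia.
  rewrite <- (rsum_single (S b) c (fun q => Zc (S q) (S b))) by lia.
  rewrite <- rsum_plus. apply rsum_ext. intros q Hq.
  change (Nat.ltb (S c) (S q)) with (Nat.ltb c q). simpl (S q - S c)%nat.
  destruct (Nat.leb_spec c q), (Nat.eqb_spec c q), (Nat.ltb_spec c q); try lia; try ring.
  subst. rewrite Nat.sub_diag, zc_0. ring.
Qed.

Lemma te_Zc b n :
  te b n = rsum (S b) (fun q => Zc (S q) (S b) * conv (fun c => te c n) zc q).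
Proof.
  transitivity (rsum (S b) (fun q => rsum (S b) (fun c =>
    te c n * (if Nat.leb c q then zc (q - c) * Zc (S q) (S b) else 0)))).
  - rewrite rsum_swap.
    rewrite (rsum_ext (S b) _ (fun c => if Nat.eqb b c then te c n else 0)).
    + symmetry. apply (rsum_single (S b) b (fun c => te c n)). lia.
    + intros c Hc. rewrite rsum_scal, Zc_inverse by lia. rewrite Nat.eqb_sym.
      destruct (Nat.eqb b c); ring.
  - apply rsum_ext. intros q Hq. unfold conv. rewrite <- rsum_scal.
    replace (S b) with (S q + (b - q))%nat at 1 by lia. rewrite rsum_app, (rsum_0 (b - q)).
    + rewrite Rplus_0_r. apply rsum_ext. intros c Hc.
      destruct (Nat.leb_spec c q); [ring|lia].
    + intros i _. destruct (Nat.leb_spec (S q + i) q); [lia|ring].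
Qed.

(** * Combination with the coefficients Z(j, p) *)

Lemma is_series_rsum_comb k (c : nat -> R) (f : nat -> nat -> R) (l : nat -> R) :
  (forall i, is_series (f i) (l i)) ->
  is_series (fun n => rsum k (fun i => c i * f i n)) (rsum k (fun i => c i * l i)).
Proof.
  intros H. induction k; cbn [rsum].
  - apply is_series_rsum. apply (is_lim_seq_ext (fun _ => 0)); [|apply is_lim_seq_const].
    intros n. symmetry. now apply rsum_0.
  - apply (is_series_plus (K := R_AbsRing) (V := R_NormedModule)); [easy|].
    now apply is_series_Rscal.
Qed.

Theorem mainTheorem9 (m p : nat) (hm : (1 <= m)%nat) (hp : (1 <= p)%nat) :
  is_series
    (fun n0 => let n := S n0 in
       2 * (Tsum (m - 1) n * Tsum (p - 1) n / (2 * INR n - 1) * (-1) ^ n))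
    ((-1) ^ (m - 1) *
     fsum 1 p (fun j => W (2 * j + 2 * m - 3) (2 * m - 1) * Zc j p)).
Proof.
  destruct m as [|a]; [lia|]. destruct p as [|b]; [lia|]. cbv zeta.
  replace (S a - 1)%nat with a by lia. replace (S b - 1)%nat with b by lia.
  (* The factor -2 is the leading 2 with the sign from shifting the index of (-1)^n by one; on the
     other side it is the factor (-1)^(2a+1) 2 of [W_qint]. *)
  assert (H := is_series_rsum_comb (S b) (fun q => -2 * Zc (S q) (S b)) _ _
    (fun q => is_series_te_moments a q)).
  rewrite fsum_rsum. replace (S (S b) - 1)%nat with (S b) by lia.
  rewrite <- rsum_scal.
  rewrite (rsum_ext (S b) _ (fun q => -2 * Zc (S q) (S b) *
    ((-1) ^ a * Lam (S (2 * q)) (fun u => acay (2 * a) u / (1 + u ^ 2))))).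
  - eapply is_series_ext; [|exact H]. intros n. cbv beta.
    match goal with |- @eq _ ?x ?y => change (@eq R x y) end.
    change (Tsum a (S n)) with (te a n). change (Tsum b (S n)) with (te b n).
    replace (2 * INR (S n) - 1) with (2 * INR n + 1) by (rewrite S_INR; ring).
    transitivity (-2 * (-1) ^ n * te a n / (2 * INR n + 1) *
      rsum (S b) (fun q => Zc (S q) (S b) * conv (fun c => te c n) zc q)).
    + rewrite <- rsum_scal. apply rsum_ext. intros q _. unfold Rdiv. ring.
    + rewrite <- te_Zc. simpl ((-1) ^ S n). unfold Rdiv. ring.
  - intros q _. change (1 + q)%nat with (S q).
    replace (2 * S q + 2 * S a - 3)%nat with (S (2 * a) + 2 * q)%nat by lia.
    replace (2 * S a - 1)%nat with (S (2 * a)) by lia.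
    rewrite W_qint, pow_1_odd.
    rewrite (Lam_ext _ _ (fun u => u ^ 0 * (acay (2 * a) u / (1 + u ^ 2)))).
    + unfold qint. ring.
    + apply cont_dom_acay_div.
    + apply cont_dom_qint.
    + intros u _. simpl. ring.
Qed.
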